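(* Let $\lambda\in(0,1)$, $\alpha_0=\frac{1-\lambda}{1+\lambda}$, and let $\alpha\in(0,\alpha_0)$. Let $(\omega_n)_{n\ge 1}$ be a sequence of positive numbers such that $\omega_n/n^{1/3}\to\infty$ and $\omega_n=o(n)$ as $n\to\infty$. Then the following asymptotic formulas for the $k$-th Fourier coefficient $\widehat{b_\lambda^n}(k)$ of $b_\lambda^n$ hold as $n\to+\infty$ ($k=k(n)$ being nonnegative integers). (1) If $k$ is fixed, then $$\widehat{b_\lambda^n}(k)\sim\frac{(-\lambda)^{n-k}\left(n(1-\lambda^2)\right)^k}{k!}.$$ (2) If $k=k(n)\to\infty$ as $n\to\infty$ with $k\le\alpha n$ or $k\ge\alpha^{-1}n$, then $$\widehat{b_\lambda^n}(k)\sim\frac{1}{\sqrt{2k\pi}}\,\frac{1}{\left[(\alpha_0-k/n)(\alpha_0^{-1}-k/n)\right]^{1/4}}\left(\frac{b_\lambda(z_+)}{z_+^{k/n}}\right)^n,$$ where $$z_+=z_+(k/n)=\frac{\frac kn(1+\lambda^2)-(1-\lambda^2)}{2\lambda\frac kn}+\sqrt{\left(\frac{\frac kn(1+\lambda^2)-(1-\lambda^2)}{2\lambda\frac kn}\right)^2-1}.$$ (3) If $k=k(n)\in[\alpha n,\alpha_0n-\omega_n]$, then $$\widehat{b_\lambda^n}(k)\sim\frac{(-1)^{n-k}}{\sqrt{2n\pi}}\,\frac{1}{\sqrt{k/n}\left[(\alpha_0^{-1}-k/n)(\alpha_0-k/n)\right]^{1/4}}\exp\left(-\frac23 n|\gamma_{\alpha_0}|^3\right),$$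 where $\gamma_{\alpha_0}^3=\frac32\left[\Phi(z_+)-i\pi\left(1-\frac kn\right)\right]$ (with $z_+$ given by the formula in (2)), and in particular $$\gamma_{\alpha_0}^3\sim-\frac{(\alpha_0-k/n)^{3/2}(1+\lambda)^{3/2}}{(\lambda(1-\lambda))^{1/2}},\qquad k/n\to\alpha_0,\ k/n<\alpha_0.$$ (4) If $k=k(n)\in[\alpha_0^{-1}n+\omega_n,\alpha^{-1}n]$, then $$\widehat{b_\lambda^n}(k)\sim\frac{1}{\sqrt{2n\pi}}\,\frac{1}{\sqrt{k/n}\left[(k/n-\alpha_0^{-1})(k/n-\alpha_0)\right]^{1/4}}\exp\left(-\frac23 n|\gamma_{\alpha_0^{-1}}|^3\right),$$ where $\gamma_{\alpha_0^{-1}}^3=\frac32\Phi(z_+)$ (with $z_+$ given by the formula in (2)), and in particular $$\gamma_{\alpha_0^{-1}}^3\sim-\frac{(k/n-\alpha_0^{-1})^{3/2}(1-\lambda)^{3/2}}{(\lambda(1+\lambda))^{1/2}},\qquad k/n\to\alpha_0^{-1},\ k/n>\alpha_0^{-1}.$$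
   Context: For $\lambda\in(0,1)$, $b_\lambda(z)=\frac{z-\lambda}{1-\lambda z}$ is the Blaschke factor, and for integers $n\ge1$, $k\ge0$, $\widehat{b_\lambda^n}(k)=\frac{1}{2i\pi}\int_{\partial\mathbb D}b_\lambda(z)^n z^{-k}\frac{dz}{z}$ is the $k$-th Taylor coefficient at $0$ of $b_\lambda^n$ ($\mathbb D$ is the open unit disk). The function $\Phi$ depends on $k/n$ and is $\Phi(z)=\Phi_{k/n}(z)=\log\left(z^{-k/n}b_\lambda(z)\right)$, understood as $\log b_\lambda(z)-\frac kn\log z$. In part (3), $\log$ is the branch with cut $[0,\infty)$ and $\log(-1)=i\pi$; in part (4), $\log$ is the principal branch. The expression $\left(b_\lambda(z_+)/z_+^{k/n}\right)^n$ means $b_\lambda(z_+)^n z_+^{-k}$. In the regimes of (3) and (4) the numbers $\gamma_{\alpha_0}^3$, $\gamma_{\alpha_0^{-1}}^3$ are real, and $|\gamma|^3$ denotes the absolute value $|\gamma^3|$. The notation $f\sim g$ means $f/g\to1$. *)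

(* Defs.v *)
From HB Require Import structures.
From mathcomp Require Import all_boot all_order all_algebra.
From mathcomp Require Import all_classical all_reals all_analysis.
From mathcomp Require Import complex.
Set Implicit Arguments.
Unset Strict Implicit.
Unset Printing Implicit Defensive.
Import Order.TTheory GRing.Theory Num.Theory.
Import numFieldNormedType.Exports.
Local Open Scope classical_set_scope.
Local Open Scope ring_scope.
Local Open Scope complex_scope.

Definition asymp_equiv (T : Type) (K : numFieldType) (F : set_system T)
    (f g : T -> K) : Prop :=
  f t / g t @[t --> F] --> (1 : K).

Notation "f ~~[ F ] g" := (asymp_equiv F f g)
  (at level 70, no associativity).

Section Complex.
Variable R : realType.
Implicit Types z : R[i].

Definition modulus z : R := Num.sqrt (complex.Re z ^+ 2 + complex.Im z ^+ 2).

Definition expi (t : R) : R[i] := cos t +i* sin t.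

(* The contour integral of [f] over the positively oriented unit circle, by
   [z = expi t], [dz = i * expi t dt]. *)
Definition circle_integral (f : R[i] -> R[i]) : R[i] :=
  let g t := f (expi t) * ('i%C * expi t) in
  (\int[lebesgue_measure]_(t in `[0, 2 * pi]) complex.Re (g t)) +i*
  (\int[lebesgue_measure]_(t in `[0, 2 * pi]) complex.Im (g t)).

(* For [z != 0], the argument in ]-pi, pi]. *)
Definition arg_principal z : R :=
  let a := acos (complex.Re z / modulus z) in
  if 0 <= complex.Im z then a else - a.

(* For [z != 0], the argument in [0, 2 * pi[; it is discontinuous across the
   positive reals and takes the value [pi] at [-1]. *)
Definition arg_cutpos z : R :=
  let a := acos (complex.Re z / modulus z) in
  if 0 <= complex.Im z then a else 2 * pi - a.

Definition log_principal z : R[i] := ln (modulus z) +i* arg_principal z.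
Definition log_cutpos z : R[i] := ln (modulus z) +i* arg_cutpos z.

End Complex.

Section Blaschke.
Variables (R : realType) (lambda : R).

Definition blaschke (z : R[i]) : R[i] :=
  (z - lambda%:C) / (1 - lambda%:C * z).

Definition fourier_coef (n k : nat) : R[i] :=
  (2 * 'i%C * pi%:C)^-1 *
  circle_integral (fun z => blaschke z ^+ n * z ^- k / z).

Definition alpha0 : R := (1 - lambda) / (1 + lambda).

(* In the quantities below [x] stands for the ratio k / n. *)

(* The radicand is positive when [0 < lambda < 1] and either [0 < x < alpha0]
   or [alpha0^-1 < x]. *)
Definition zplus (x : R) : R :=
  let c := (x * (1 + lambda ^+ 2) - (1 - lambda ^+ 2)) / (2 * lambda * x) in
  c + Num.sqrt (c ^+ 2 - 1).

(* log (z ^ (- x) * b(z)) for the determination [log] of the logarithm. *)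
Definition Phi (log : R[i] -> R[i]) (x : R) (z : R[i]) : R[i] :=
  log (blaschke z) - x%:C * log z.

(* These are the cubes gamma ^ 3; the numbers gamma are not used. *)
Definition gamma3_alpha0 (x : R) : R[i] :=
  (3 / 2) * (Phi (@log_cutpos R) x (zplus x)%:C - 'i%C * pi%:C * (1 - x%:C)).

Definition gamma3_alpha0V (x : R) : R[i] :=
  (3 / 2) * Phi (@log_principal R) x (zplus x)%:C.

End Blaschke.

(* Main.v *)
Require Import Defs.
From HB Require Import structures.
From mathcomp Require Import all_boot all_order all_algebra.
From mathcomp Require Import all_classical all_reals all_analysis.
From mathcomp Require Import measurable_realfun complex.
From mathcomp Require Import ring lra zify.
Import Order.TTheory GRing.Theory Num.Theory.
Import numFieldNormedType.Exports ComplexField.Normc.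
Local Open Scope classical_set_scope.
Local Open Scope ring_scope.
Local Open Scope complex_scope.

(** For every real [rho] with [0 < |rho| < 1 / lambda], the [k]-th Taylor
    coefficient of [b ^ n] is [1 / (2 pi)] times the integral over [0, 2 pi] of
    [b(z) ^ n * z ^ (- k)] along [z = rho * e^(it)]; this is [circle_int_blaschke].
    Indeed, truncating the geometric series of [1 / (1 - lambda z)] gives
    polynomials which converge to [b ^ n] uniformly on each such circle and whose
    [k]-th coefficient is the explicit Cauchy product [blaschke_coef n k] as
    soon as the truncation order exceeds [k].  For fixed [k] the asymptotics is read
    off this product ([blaschke_coef_fixed]).

    When [k] tends to infinity, the circle is taken through the real critical
    point [z_+] of [log b(z) - x log z], where [x = k / n].  With
    [E = e^(i theta) - 1],
<<
      b (z_+ e^(i theta)) = b (z_+) * (1 + p E) / (1 - q E)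
>>
    for two real numbers [p] and [q], and the critical point equation is
    [p + q = x].  So the integrand is [b(z_+) ^ n * z_+ ^ (- k)] times the [n]-th
    power of [w (theta) = (1 + p E) / (1 - q E) * e^(- i x theta)].  Two estimates
    on [w], both uniform in [x], are enough:
    - [w (theta) = 1 - v theta ^ 2 / 2 + O ((x + x ^ 3) |theta| ^ 3)], where [v] is
      [x] times the square root of [D = (alpha0 - x) (1 / alpha0 - x)]
      ([local_factor_taylor], [zplus_local_var]);
    - [|w (theta)| ^ 2 * (1 + c v (1 - cos theta)) <= 1] ([local_factor_decay]).
    Put [theta = u / tau] with [tau ^ 2 = n v / 2].  The first estimate gives
    [w ^ n --> exp (- u ^ 2)] provided that [n (x + x ^ 3) / tau ^ 3 --> 0], the
    second one gives [|w ^ n| <= C / (1 + u ^ 2)].  Dominated convergence and the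
    Gaussian integral then give the saddle point formula [blaschke_coef_saddle] under that
    single condition.  Its fourth power is rational in [n], [k] and [D], and is
    checked when [x] stays away from [alpha0] and [1 / alpha0] ([away_err]), and
    near these two points at distance [omega n / n] ([left_err], [right_err]);
    there it follows from [n / omega n ^ 3 --> 0], that is, from
    [omega n / n ^ (1 / 3) --> +oo].

    Near [alpha0] and [1 / alpha0], the factor [b(z_+) ^ n * z_+ ^ (- k)] is, up to
    sign, [exp (n * h)], where [h] is the critical value of
    [log |b| - x log |z|] and [gamma ^ 3 = 3 / 2 * h].  Differentiating along the
    curve of critical points, [h' = - x' log |z_+|]: hence [h <= 0], which is what
    turns [h] into [- |h|], and [h] vanishes to third order at [|z_+| = 1], while
    the distance from [x] to [alpha0] or [1 / alpha0] vanishes to second order.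
    This gives the power [3 / 2] and the constants in the equivalents of
    [gamma ^ 3]. *)

(** * Real inequalities, powers and limits *)

Section RealBounds.
Context {R : realType}.
Implicit Types t x y : R.

Lemma derive_ge0_le (f df : R -> R) x :
  (forall t, is_derive t 1 f (df t)) -> (forall t, 0 <= t -> 0 <= df t) ->
  0 <= x -> f 0 <= f x.
Proof.
move=> fdf df0 x0.
have [|c cx e] := @MVT_segment _ f df _ _ x0 (fun c _ => fdf c).
  by apply: derivable_within_continuous => c _; apply: ex_derive.
by rewrite -subr_ge0 e subr0 mulr_ge0// df0//; move: cx; rewrite in_itv/= => /andP[].
Qed.

Lemma even_ge0 (P : R -> Prop) : (forall t, P `|t| -> P t) ->
  (forall t, 0 <= t -> P t) -> forall t, P t.
Proof. by move=> Pn P0 t; apply/Pn/P0/normr_ge0. Qed.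

Lemma sin_le_id t : 0 <= t -> sin t <= t.
Proof.
move=> t0; rewrite -subr_ge0.
have := @derive_ge0_le (fun t => t - sin t) (fun t => 1 - cos t) t.
rewrite sin0 subr0; apply => // u _; exact: cos_le1.
Qed.

Lemma cos_ge1B t : 1 - cos t <= t ^+ 2 / 2.
Proof.
move: t; apply: even_ge0 => t.
  by rewrite cos_norm real_normK// num_real.
move=> t0; rewrite -subr_ge0.
have := @derive_ge0_le (fun t => t ^+ 2 / 2 - (1 - cos t)) (fun t => t - sin t) t.
rewrite cos0 subrr expr0n/= mul0r subr0; apply => // u.
  by apply: is_derive_eq; rewrite /GRing.scale/=; field.
by move=> u0; rewrite subr_ge0 sin_le_id.
Qed.

Lemma cos_ge1Bid t : 0 <= t -> 1 - cos t <= t.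
Proof.
move=> t0; have [t2|t2] := leP t 2.
  have := cos_ge1B t; nra.
have := cos_geN1 t; lra.
Qed.

Lemma sin_bound2 t : 0 <= t -> 0 <= t - sin t <= t ^+ 2 / 2.
Proof.
move=> t0; rewrite subr_ge0 sin_le_id//= -subr_ge0.
have := @derive_ge0_le (fun t => t ^+ 2 / 2 - (t - sin t)) (fun t => t - (1 - cos t)) t.
rewrite sin0 expr0n/= mul0r !subr0; apply => // u.
  by apply: is_derive_eq; rewrite /GRing.scale/=; field.
by move=> u0; rewrite subr_ge0 cos_ge1Bid.
Qed.

Lemma sin_bound3 t : 0 <= t -> t - sin t <= t ^+ 3 / 6.
Proof.
move=> t0; rewrite -subr_ge0.
have := @derive_ge0_le (fun t => t ^+ 3 / 6 - (t - sin t))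
  (fun t => t ^+ 2 / 2 - (1 - cos t)) t.
rewrite sin0 expr0n/= mul0r !subr0; apply => // u.
  by apply: is_derive_eq; rewrite /GRing.scale/=; field.
by move=> u0; rewrite subr_ge0 cos_ge1B.
Qed.

Lemma cos_bound3 t : 0 <= t -> 0 <= cos t - 1 + t ^+ 2 / 2 <= t ^+ 3 / 6.
Proof.
move=> t0; apply/andP; split; first by have := cos_ge1B t; lra.
rewrite -subr_ge0.
have := @derive_ge0_le (fun t => t ^+ 3 / 6 - (cos t - 1 + t ^+ 2 / 2))
  (fun t => t ^+ 2 / 2 - (t - sin t)) t.
rewrite cos0 !expr0n/= !mul0r subrr addr0 !subr0; apply => // u.
  by apply: is_derive_eq; rewrite /GRing.scale/=; field.
by move=> u0; rewrite subr_ge0; case/andP: (sin_bound2 u u0).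
Qed.

(** The remainders of [expi] are needed at every order and without restriction to
    small [t], because they are also taken at [x * theta], where [x] is unbounded. *)
Lemma sin_norm_bounds t : [/\ `|sin t| <= `|t|, `|sin t - t| <= t ^+ 2
   & `|sin t - t| <= `|t| ^+ 3 / 2].
Proof.
wlog t0 : t / 0 <= t => [hw|].
  have [/hw//|/ltW t0] := leP 0 t.
  have := hw (- t); rewrite oppr_ge0 sinN !normrN sqrrN => /(_ t0).
  by rewrite opprK (_ : - sin t + t = - (sin t - t)) ?normrN//; ring.
have /andP[h0 h1] := sin_bound2 t t0; have h2 := sin_bound3 t t0.
have h3 : 0 <= t ^+ 3 by rewrite exprn_ge0.
rewrite (ger0_norm t0) (distrC _ t) (ger0_norm h0); split.
- rewrite ler_norml; apply/andP; split; last by rewrite -subr_ge0.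
  have := @derive_ge0_le (fun t => t + sin t) (fun t => 1 + cos t) t.
  rewrite sin0 addr0 => h; suff : 0 <= t + sin t by lra.
  apply: h => // u _; have := cos_geN1 u; lra.
- have := sqr_ge0 t; lra.
- lra.
Qed.

Lemma cos_norm_bounds t : [/\ `|cos t - 1| <= `|t|, `|cos t - 1| <= t ^+ 2
   & `|cos t - 1 + t ^+ 2 / 2| <= `|t| ^+ 3 / 2].
Proof.
wlog t0 : t / 0 <= t => [hw|].
  have := hw `|t|; rewrite normr_ge0 cos_norm normr_id real_normK ?num_real//; exact.
have h0 := cos_ge1B t; have h1 := cos_ge1Bid t t0; have /andP[h2 h3] := cos_bound3 t t0.
have h4 := cos_le1 t; have h5 : 0 <= t ^+ 3 by rewrite exprn_ge0.
rewrite (ger0_norm t0) (ger0_norm h2) ler0_norm ?subr_le0//; split; lra.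
Qed.

(** Halving the angle reduces the claim to [sin u >= u / 3] on [0, 2], which
    follows from [sin u >= u - u ^ 3 / 6].  The constant 18 is not sharp, but it
    only uses [pi <= 4]. *)
Lemma cos_quadratic_gap t : `|t| <= pi -> t ^+ 2 / 18 <= 1 - cos t.
Proof.
move: t; apply: even_ge0 => t.
  by rewrite cos_norm real_normK ?num_real// normr_id.
move=> t0; rewrite ger0_norm// => tpi.
have hs : t / 6 <= sin (t / 2).
  have h2 : 0 <= t / 2 by rewrite divr_ge0.
  have := sin_bound3 _ h2.
  have ht : t / 2 <= 2.
    by rewrite (le_trans _ (ltW (pihalf_lt2 _)))// ler_pM2r// invr_gt0.
  have -> : t / 6 = t / 2 / 3 by field.
  move: h2 ht; move: (t / 2) (sin (t / 2)) => u s h2 ht h3.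
  have : 0 <= u * (2 - u) * (2 + u) by rewrite !mulr_ge0//; lra.
  nra.
have -> : 1 - cos t = 2 * sin (t / 2) ^+ 2.
  rewrite {1}(_ : t = (t / 2) *+ 2) ?cos_mulr2n ?cos2sin2; last by rewrite mulr2n; field.
  by rewrite mulr2n; ring.
have : 0 <= t / 6 by lra.
nra.
Qed.

Lemma expRN_bound x : 0 <= x -> `|expR (- x) - (1 - x)| <= x ^+ 2.
Proof.
move=> x0; have h1 := expR_ge1Dx (- x); rewrite ger0_norm; last by lra.
have h2 := expR_ge1Dx x; rewrite expRN.
have e0 := expR_gt0 x.
have : (expR x)^-1 <= (1 + x)^-1 by rewrite lef_pV2// ?posrE; lra.
have : (1 + x)^-1 <= 1 - x + x ^+ 2.
  rewrite -[X in X <= _]mul1r ler_pdivrMr; last by lra.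
  have : 0 <= x ^+ 3 by rewrite exprn_ge0.
  nra.
lra.
Qed.

(** Bernoulli's inequality for the exponent [n / 2], squared: two powers of the
    linear bound are what makes the square root [|w ^ n|] integrable below. *)
Lemma exprn_ge_sqr (a : R) n : (2 <= n)%N -> 0 <= a ->
  (1 + n%:R * a / 3) ^+ 2 <= (1 + a) ^+ n.
Proof.
move=> n2 a0.
have bern m : 1 + m%:R * a <= (1 + a) ^+ m.
  elim: m => [|m ih]; first by rewrite mul0r addr0.
  rewrite exprS -natr1; have : 0 <= m%:R * a * a by rewrite !mulr_ge0.
  nra.
have hn : (n%:R : R) <= 3 * (n./2)%:R.
  by rewrite -natrM ler_nat; lia.
rewrite (@le_trans _ _ ((1 + a) ^+ (n./2 * 2)))//.
  rewrite exprM lerXn2r// ?nnegrE; [| by rewrite exprn_ge0//; lra|].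
    by rewrite addr_ge0// divr_ge0// mulr_ge0.
  apply: le_trans (bern _); nra.
by rewrite ler_weXn2l//; [lra|rewrite -[leqRHS](odd_double_half n) muln2 leq_addl].
Qed.

Lemma powR14 (a : R) : 0 <= a -> a `^ (1 / 4) = Num.sqrt (Num.sqrt a).
Proof.
move=> a0; have -> : 1 / 4 = 2^-1 * 2^-1 :> R by field.
by rewrite powRrM !powR12_sqrt ?powR_ge0.
Qed.

Lemma powR32 (a : R) : 0 <= a -> a `^ (3 / 2) = Num.sqrt a ^+ 3.
Proof.
move=> a0; rewrite (_ : 3 / 2 = 2^-1 * 3%:R); last by field.
by rewrite powRrM powR12_sqrt// powR_mulrn// sqrtr_ge0.
Qed.

Lemma cvg_expn (T : Type) (F : set_system T) {FF : Filter F}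
  (f : T -> R) (a : R) n : f x @[x --> F] --> a -> f x ^+ n @[x --> F] --> a ^+ n.
Proof.
move=> fa; elim: n => [|n ih]; first by under eq_fun do rewrite expr0; exact: cvg_cst.
by under eq_fun do rewrite exprS; rewrite exprS; exact: cvgM.
Qed.

Lemma cvg_nV : (n%:R)^-1 @[n --> \oo] --> (0 : R).
Proof. by rewrite -cvg_shiftS; exact: cvg_harmonic. Qed.

End RealBounds.

(** * Complex numbers as pairs of reals *)

Section ComplexTools.
Context {R : realType}.
Implicit Types (t x y : R) (z w : R[i]).

Lemma normc_ReIm z : normc z = Num.sqrt (complex.Re z ^+ 2 + complex.Im z ^+ 2).
Proof. by case: z. Qed.

Lemma normc_ge0 z : 0 <= normc z.
Proof. by rewrite normc_ReIm sqrtr_ge0. Qed.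

Lemma sqr_normcE z : normc z ^+ 2 = complex.Re z ^+ 2 + complex.Im z ^+ 2.
Proof. by rewrite normc_ReIm sqr_sqrtr// addr_ge0// sqr_ge0. Qed.

Lemma normc_real x : normc x%:C = `|x|.
Proof. by rewrite normc_ReIm/= expr0n/= addr0 sqrtr_sqr. Qed.

Lemma norm_normc z : `|z| = (normc z)%:C.
Proof. by rewrite normc_def -normc_ReIm. Qed.

Lemma Re_le_normc z : `|complex.Re z| <= normc z.
Proof. by rewrite normc_ReIm -sqrtr_sqr ler_wsqrtr// lerDl sqr_ge0. Qed.

Lemma Im_le_normc z : `|complex.Im z| <= normc z.
Proof. by rewrite normc_ReIm -sqrtr_sqr ler_wsqrtr// lerDr sqr_ge0. Qed.

Lemma normc_le_ReIm z : normc z <= `|complex.Re z| + `|complex.Im z|.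
Proof.
rewrite [in leLHS](complexE z); apply: le_trans (le_normcD _ _) _.
by rewrite normcM !normc_real normc_ReIm/= expr0n/= add0r expr1n sqrtr1 mul1r.
Qed.

Lemma normcX z n : normc (z ^+ n) = normc z ^+ n.
Proof. by elim: n => [|n ih]; rewrite ?expr0 ?normc1// !exprS normcM ih. Qed.

Lemma le_normcB z w : normc (z - w) <= normc z + normc w.
Proof. by rewrite -(normcN w) le_normcD. Qed.

(** Comparing [n]-th powers of two points of the unit disk costs only a factor
    [n], so an [n]-th power converges as soon as its base is known up to [o (1 / n)]. *)
Lemma normcX_sub z w n : normc z <= 1 -> normc w <= 1 ->
  normc (z ^+ n - w ^+ n) <= n%:R * normc (z - w).
Proof.
move=> z1 w1; elim: n => [|n ih]; first by rewrite !expr0 subrr normc0 mul0r.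
have -> : z ^+ n.+1 - w ^+ n.+1 = z * (z ^+ n - w ^+ n) + (z - w) * w ^+ n.
  by rewrite !exprS; ring.
apply: le_trans (le_normcD _ _) _; rewrite !normcM normcX -natr1 mulrDl mul1r lerD//.
  by apply: le_trans ih; rewrite ler_piMl ?normc_ge0.
by rewrite ler_piMr ?normc_ge0// exprn_ile1 ?normc_ge0.
Qed.

Lemma normc_expi t : normc (expi t) = 1.
Proof. by rewrite normc_ReIm/= cos2Dsin2 sqrtr1. Qed.

Lemma expi0 : expi 0 = 1 :> R[i].
Proof. by rewrite /expi cos0 sin0. Qed.

Lemma expiD t x : expi (t + x) = expi t * expi x.
Proof.
rewrite /expi cosD sinD; apply/eqP.
by rewrite eq_complex/= addrC eqxx (addrC (sin t * _)) eqxx.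
Qed.

Lemma expi_neq0 t : expi t != 0.
Proof.
by apply/eqP => h; have := normc_expi t; rewrite h normc0 => /eqP; rewrite eq_sym oner_eq0.
Qed.

Lemma expiV t : (expi t)^-1 = expi (- t).
Proof.
apply: (mulfI (expi_neq0 t)); rewrite -expiD subrr expi0 mulfV//; exact: expi_neq0.
Qed.

Lemma expiX t n : expi t ^+ n = expi (n%:R * t).
Proof.
elim: n => [|n ih]; first by rewrite expr0 mul0r expi0.
by rewrite exprS ih -expiD -natr1 mulrDl mul1r addrC.
Qed.

Lemma expiDpi t : expi (pi + t) = - expi t.
Proof. by rewrite /expi addrC cosDpi sinDpi. Qed.

Lemma expi_taylor0 t : normc (expi t - 1) <= 2 * `|t|.
Proof.
apply: le_trans (normc_le_ReIm _) _ => /=; rewrite subr0.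
by have [h _ _] := cos_norm_bounds t; have [h' _ _] := sin_norm_bounds t; lra.
Qed.

Lemma expi_taylor1 t : normc (expi t - 1 - 'i * t%:C) <= 2 * `|t| ^+ 2.
Proof.
apply: le_trans (normc_le_ReIm _) _ => /=.
rewrite !(mul0r, mulr0, mul1r, oppr0, subr0, add0r, addr0) real_normK ?num_real//.
by have [_ h _] := cos_norm_bounds t; have [_ h' _] := sin_norm_bounds t; lra.
Qed.

Lemma expi_taylor2 t :
  normc (expi t - 1 - 'i * t%:C + (t ^+ 2 / 2)%:C) <= `|t| ^+ 3.
Proof.
apply: le_trans (normc_le_ReIm _) _ => /=.
rewrite !(mul0r, mulr0, mul1r, oppr0, subr0, add0r, addr0).
by have [_ _ h] := cos_norm_bounds t; have [_ _ h'] := sin_norm_bounds t; lra.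
Qed.

(** Stated on real and imaginary parts because all the integrals below are
    integrals of real functions. *)
Definition ccontinuous (f : R -> R[i]) :=
  continuous (fun t => complex.Re (f t)) /\ continuous (fun t => complex.Im (f t)).

Lemma ccontinuous_cst z : ccontinuous (fun=> z).
Proof. by split => t; exact: cvg_cst. Qed.

Lemma ccontinuous_expi : ccontinuous (@expi R).
Proof. by split => t; [exact: continuous_cos|exact: continuous_sin]. Qed.

Lemma ccontinuousB f g : ccontinuous f -> ccontinuous g ->
  ccontinuous (fun t => f t - g t).
Proof.
move=> [fr fi] [gr gi]; split => t.
  rewrite (_ : (fun _ => _) = (fun t => complex.Re (f t) - complex.Re (g t))); last first.
    by apply/funext => u; case: (f u) (g u) => ? ? [].
  by apply: cvgB; [exact: fr|exact: gr].
rewrite (_ : (fun _ => _) = (fun t => complex.Im (f t) - complex.Im (g t))); last first.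
  by apply/funext => u; case: (f u) (g u) => ? ? [].
by apply: cvgB; [exact: fi|exact: gi].
Qed.

Lemma ccontinuousM f g : ccontinuous f -> ccontinuous g ->
  ccontinuous (fun t => f t * g t).
Proof.
move=> [fr fi] [gr gi]; split => t.
  rewrite (_ : (fun _ => _) = (fun t => complex.Re (f t) * complex.Re (g t)
     - complex.Im (f t) * complex.Im (g t))); last first.
    by apply/funext => u; case: (f u) (g u) => ? ? [].
  by apply: cvgB; apply: cvgM; [exact: fr|exact: gr|exact: fi|exact: gi].
rewrite (_ : (fun _ => _) = (fun t => complex.Re (f t) * complex.Im (g t)
     + complex.Im (f t) * complex.Re (g t))); last first.
  by apply/funext => u; case: (f u) (g u) => ? ? [].
by apply: cvgD; apply: cvgM; [exact: fr|exact: gi|exact: fi|exact: gr].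
Qed.

Lemma ccontinuousX f n : ccontinuous f -> ccontinuous (fun t => f t ^+ n).
Proof.
move=> cf; elim: n => [|n ih].
  by rewrite (_ : (fun _ => _) = fun=> 1) //; exact: ccontinuous_cst.
rewrite (_ : (fun _ => _) = fun t => f t * f t ^+ n); last first.
  by apply/funext => u; rewrite exprS.
exact: ccontinuousM.
Qed.

Lemma ccontinuousV f : ccontinuous f -> (forall t, f t != 0) ->
  ccontinuous (fun t => (f t)^-1).
Proof.
move=> [fr fi] f0.
have n0 t : complex.Re (f t) ^+ 2 + complex.Im (f t) ^+ 2 != 0.
  rewrite -sqr_normcE sqrf_eq0; apply/eqP => /eq0_normc /eqP; exact/negP.
have cn : continuous (fun t => (complex.Re (f t) ^+ 2 + complex.Im (f t) ^+ 2)^-1).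
  move=> t; apply: cvgV; first exact: n0.
  by apply: cvgD; apply: cvgM; [exact: fr|exact: fr|exact: fi|exact: fi].
split => t.
  rewrite (_ : (fun _ => _) = (fun t => complex.Re (f t) *
     (complex.Re (f t) ^+ 2 + complex.Im (f t) ^+ 2)^-1)); last first.
    by apply/funext => u; case: (f u).
  by apply: cvgM; [exact: fr|exact: cn].
rewrite (_ : (fun _ => _) = (fun t => - (complex.Im (f t) *
     (complex.Re (f t) ^+ 2 + complex.Im (f t) ^+ 2)^-1))); last first.
  by apply/funext => u; case: (f u).
by apply: cvgN; apply: cvgM; [exact: fi|exact: cn].
Qed.

Lemma cvg_numField (K : numFieldType) (u : nat -> K) (l : K) :
  (forall e, 0 < e -> \forall n \near \oo, `|l - u n| < e) ->
  u n @[n --> \oo] --> l.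
Proof. by move=> h; apply/cvgrPdist_lt. Qed.

Lemma cvg_real_complex (u : nat -> R) x : u n @[n --> \oo] --> x ->
  (u n)%:C @[n --> \oo] --> (x%:C : (R[i] : numFieldType)).
Proof.
move=> ux; apply: (@cvg_numField (R[i] : numFieldType)) => e e0.
have := e0; rewrite ltcE/= => /andP[/eqP ei er].
have -> : e = (complex.Re e)%:C by rewrite [LHS]complexE ei mulr0 addr0.
move/cvgrPdist_lt : ux => /(_ _ er); apply: filterS => n.
by rewrite -rmorphB/= norm_normc normc_real ltcR.
Qed.

Lemma asymp_equiv_real (f g : nat -> R) :
  f n / g n @[n --> \oo] --> (1 : R) ->
  (fun n => (f n)%:C) ~~[\oo] (fun n => (g n)%:C).
Proof.
move=> fg; rewrite /asymp_equiv.
rewrite (_ : (fun _ => _) = (fun n => (f n / g n)%:C)); first exact: cvg_real_complex.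
by apply/funext => n; rewrite fmorph_div.
Qed.

Lemma asymp_equiv_near (f f' g g' : nat -> R[i]) :
  (\forall n \near \oo, f n = f' n) -> (\forall n \near \oo, g n = g' n) ->
  f' ~~[\oo] g' -> f ~~[\oo] g.
Proof.
move=> ff' gg'; apply: cvg_trans; apply: near_eq_cvg.
by near=> n; congr (_ / _); apply/esym; near: n.
Unshelve. all: by end_near. Qed.

End ComplexTools.

(** * Integrals over circles *)

Section Cint.
Context {R : realType}.
Implicit Types (f g : R -> R) (F G : R -> R[i]).
Notation mu := (@lebesgue_measure R).

Lemma continuous_integrable f (a b : R) : continuous f ->
  mu.-integrable `[a, b] (EFin \o f).
Proof.
move=> cf; apply: continuous_compact_integrable; first exact: segment_compact.
exact: continuous_subspaceT.
Qed.

Lemma twopi_gt0 : 0 < 2 * pi :> R.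
Proof. by rewrite mulr_gt0// pi_gt0. Qed.

Lemma measure_circle : fine (mu `[0%R, 2 * pi]) = 2 * pi :> R.
Proof. by rewrite lebesgue_measure_itv/= lte_fin twopi_gt0/= subr0. Qed.

Definition circle_int F : R[i] :=
  (\int[mu]_(t in `[0, 2 * pi]) complex.Re (F t)) +i*
  (\int[mu]_(t in `[0, 2 * pi]) complex.Im (F t)).

Lemma eq_circle_int F G : F =1 G -> circle_int F = circle_int G.
Proof. by move=> FG; congr circle_int; apply/funext. Qed.

Lemma circle_intD F G : ccontinuous F -> ccontinuous G ->
  circle_int (fun t => F t + G t) = circle_int F + circle_int G.
Proof.
move=> [Fr Fi] [Gr Gi].
rewrite /circle_int; apply/eqP; rewrite eq_complex/=; apply/andP; split; apply/eqP.
  rewrite -RintegralD//; try exact: continuous_integrable.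
  by apply: eq_Rintegral => t _; case: (F t) (G t) => ? ? [].
rewrite -RintegralD//; try exact: continuous_integrable.
by apply: eq_Rintegral => t _; case: (F t) (G t) => ? ? [].
Qed.

Lemma circle_intZ c F : ccontinuous F -> circle_int (fun t => c * F t) = c * circle_int F.
Proof.
move=> [Fr Fi]; case: c => a b.
rewrite /circle_int; apply/eqP; rewrite eq_complex/=; apply/andP; split; apply/eqP.
  rewrite -!RintegralZl//; try exact: continuous_integrable.
  rewrite -RintegralB//.
  - by apply: eq_Rintegral => t _; case: (F t).
  - by apply: continuous_integrable => t; apply: cvgM; [exact: cvg_cst|exact: Fr].
  - by apply: continuous_integrable => t; apply: cvgM; [exact: cvg_cst|exact: Fi].
rewrite -!RintegralZl//; try exact: continuous_integrable.
rewrite -RintegralD//.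
- by apply: eq_Rintegral => t _; case: (F t).
- by apply: continuous_integrable => t; apply: cvgM; [exact: cvg_cst|exact: Fi].
- by apply: continuous_integrable => t; apply: cvgM; [exact: cvg_cst|exact: Fr].
Qed.

Lemma ccontinuousD F G : ccontinuous F -> ccontinuous G ->
  ccontinuous (fun t => F t + G t).
Proof.
move=> cF cG; rewrite (_ : (fun _ => _) = fun t => F t - (0 - G t)).
  by apply: ccontinuousB => //; apply: ccontinuousB => //; exact: ccontinuous_cst.
by apply/funext => t; rewrite sub0r opprK.
Qed.

Lemma circle_int0 : circle_int (fun=> 0) = 0.
Proof.
by rewrite (_ : (fun=> 0) = fun=> 0 * 0) ?circle_intZ ?mul0r//; exact: ccontinuous_cst.
Qed.

Lemma circle_int_sum (I : Type) (r : seq I) (H : I -> R -> R[i]) :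
  (forall i, ccontinuous (H i)) ->
  ccontinuous (fun t => \sum_(i <- r) H i t) /\
  circle_int (fun t => \sum_(i <- r) H i t) = \sum_(i <- r) circle_int (H i).
Proof.
move=> cH; elim: r => [|i r [ihc ih]].
  rewrite big_nil; under eq_fun do rewrite big_nil.
  by split; [exact: ccontinuous_cst|exact: circle_int0].
rewrite big_cons; under eq_fun do rewrite big_cons.
by split; [exact: ccontinuousD|rewrite circle_intD// ih].
Qed.

Lemma normc_circle_int_le F M : ccontinuous F ->
  (forall t, normc (F t) <= M) -> normc (circle_int F) <= 4 * pi * M.
Proof.
move=> [Fr Fi] FM.
have bnd f : continuous f -> (forall t, `|f t| <= M) ->
    `|\int[mu]_(t in `[0, 2 * pi]) f t| <= 2 * pi * M.
  move=> cf fM; apply: le_trans (le_normr_Rintegral _ _) _ => //.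
    exact: continuous_integrable.
  have -> : 2 * pi * M = \int[mu]_(t in `[0, 2 * pi]) M.
    by rewrite Rintegral_cst// measure_circle mulrC.
  apply: le_Rintegral => //.
    by apply: continuous_integrable => t; apply: cvg_norm; exact: cf.
  by apply: continuous_integrable => t; exact: cvg_cst.
apply: le_trans (normc_le_ReIm _) _ => /=.
have h1 := bnd _ Fr (fun t => le_trans (Re_le_normc _) (FM t)).
have h2 := bnd _ Fi (fun t => le_trans (Im_le_normc _) (FM t)).
have -> : 4 * pi * M = 2 * pi * M + 2 * pi * M by ring.
exact: lerD.
Qed.

Lemma circle_int_cst c : circle_int (fun=> c) = (2 * pi)%:C * c.
Proof.
case: c => a b; rewrite /circle_int !Rintegral_cst// measure_circle; apply/eqP.
by rewrite eq_complex/= !mul0r subr0 addr0 !(mulrC (2 * pi)) !eqxx.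
Qed.

Lemma Rintegral_FTC (F f : R -> R) (a b : R) : a < b ->
  (forall t : R, is_derive t 1 F (f t)) -> continuous f ->
  \int[mu]_(t in `[a, b]) f t = F b - F a.
Proof.
move=> ab Ff cf; rewrite /Rintegral.
rewrite (@continuous_FTC2 _ f F a b)//.
- exact: continuous_subspaceT.
- have cF : continuous F.
    by move=> t; apply: differentiable_continuous; apply/derivable1_diffP; exact: ex_derive.
  split; first by move=> t _; exact: ex_derive.
    exact: cvg_at_right_filter (cF _).
  exact: cvg_at_left_filter (cF _).
- by move=> t _; rewrite derive1E; apply: derive_val.
Qed.

Lemma circle_int_expi a : a != 0 -> expi (a * (2 * pi)) = 1 ->
  circle_int (fun t => expi (a * t)) = 0.
Proof.
move=> a0 ea.
have /eqP := ea; rewrite eq_complex/= => /andP[/eqP ce /eqP se].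
have ct : continuous (fun t : R => a * t).
  by move=> t; apply: cvgM; [exact: cvg_cst|exact: cvg_id].
rewrite /circle_int; apply/eqP; rewrite eq_complex/=; apply/andP; split; apply/eqP.
  have d (t : R) : is_derive t 1 (fun t : R => sin (a * t) / a) (cos (a * t)).
    by apply: is_derive_eq; rewrite /GRing.scale/=; field.
  rewrite (Rintegral_FTC _ _ _ _ twopi_gt0 d).
    by rewrite se mulr0 sin0 !mul0r subrr.
  by move=> t; apply: continuous_comp; [exact: ct|exact: continuous_cos].
have d (t : R) : is_derive t 1 (fun t : R => - cos (a * t) / a) (sin (a * t)).
  by apply: is_derive_eq; rewrite /GRing.scale/=; field.
rewrite (Rintegral_FTC _ _ _ _ twopi_gt0 d).
  by rewrite ce mulr0 cos0 subrr.
by move=> t; apply: continuous_comp; [exact: ct|exact: continuous_sin].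
Qed.

Lemma expi_2pin (n : nat) : expi (n%:R * (2 * pi)) = 1 :> R[i].
Proof.
rewrite -expiX /expi (_ : 2 * pi = pi *+ 2) ?cos2pi ?sin2pi ?expr1n//.
by rewrite mulr2n; ring.
Qed.

Lemma circle_int_expi_diff (i k : nat) :
  circle_int (fun t => expi ((i%:R - k%:R) * t)) = ((2 * pi) *+ (i == k))%:C.
Proof.
have [->|ik] := eqVneq i k.
  under eq_circle_int do rewrite subrr mul0r expi0.
  by rewrite circle_int_cst mulr1 mulr1n.
rewrite mulr0n circle_int_expi//; first by rewrite subr_eq0 eqr_nat.
by rewrite mulrBl expiD -expiV !expi_2pin invr1 mulr1.
Qed.

Lemma ccontinuous_expiM (a : R) : ccontinuous (fun t => expi (a * t)).
Proof.
have ct : continuous (fun t : R => a * t).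
  by move=> t; apply: cvgM; [exact: cvg_cst|exact: cvg_id].
split => t; apply: continuous_comp; try exact: ct.
  exact: continuous_cos.
exact: continuous_sin.
Qed.

(** Orthogonality of the exponentials: the integral of [p(z) z ^ (- k)] sees only
    the [k]-th coefficient, whatever the radius. *)
Lemma circle_int_poly (p : {poly R}) (rho : R) k : rho != 0 ->
  circle_int (fun t => (map_poly (real_complex R) p).[rho%:C * expi t] * (rho%:C * expi t) ^- k)
    = (2 * pi * p`_k)%:C.
Proof.
move=> rho0.
have e t : (map_poly (real_complex R) p).[rho%:C * expi t] * (rho%:C * expi t) ^- k =
    \sum_(i < size p) (p`_i * rho ^+ i * rho ^- k)%:C * expi ((i%:R - k%:R) * t).
  rewrite horner_coef size_map_poly mulr_suml; apply: eq_bigr => i _.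
  rewrite coef_map/= !exprMn mulrBl expiD -expiV -!expiX invfM !rmorphM/= fmorphV/= !rmorphXn/=.
  by ring.
rewrite (eq_circle_int _ _ e).
have [|_ ->] := @circle_int_sum _ (index_enum 'I_(size p)) (fun i t =>
   (p`_i * rho ^+ i * rho ^- k)%:C * expi ((i%:R - k%:R) * t)).
  move=> i; apply: ccontinuousM; [exact: ccontinuous_cst|exact: ccontinuous_expiM].
rewrite (eq_bigr (fun i : 'I_(size p) =>
    if i == k :> nat then (2 * pi * p`_k)%:C else 0)); last first.
  move=> i _; rewrite circle_intZ; last exact: ccontinuous_expiM.
  rewrite circle_int_expi_diff -rmorphM/=; case: eqP => [->|_]; last by rewrite mulr0n mulr0.
  by rewrite mulr1n; congr (_%:C); field; rewrite expf_neq0.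
rewrite -big_mkcond/=; have [kp|kp] := ltnP k (size p).
  by rewrite (big_pred1 (Ordinal kp)).
rewrite nth_default// mulr0 big_pred0// => i.
by apply/negbTE/eqP => ik; move: (ltn_ord i); rewrite ik ltnNge kp.
Qed.

End Cint.

(** * The coefficients of the powers of a Blaschke factor *)

Section Coef.
Context {R : realType} (lambda : R).
Implicit Types (rho : R) (n k M m : nat).

Definition geom_poly M : {poly R} := \sum_(i < M) (lambda *: 'X) ^+ i.

Lemma geom_polyE M : (1 - lambda *: 'X) * geom_poly M = 1 - (lambda *: 'X) ^+ M.
Proof. by rewrite -opprB mulNr -subrX1 opprB. Qed.

(** Below the truncation order, the powers of the truncated geometric series have
    the coefficients of the negative binomial series: multiplying by
    [1 - lambda X] lowers [n], which is Pascal's rule. *)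
Lemma coef_geom_polyX n M m : (m < M)%N ->
  (geom_poly M ^+ n)`_m = lambda ^+ m *+ 'C((n + m).-1, m).
Proof.
elim: n m => [|n ihn] m mM.
  rewrite expr0 coef1; case: m mM => [|m] mM; first by rewrite expr0.
  by rewrite bin_small// mulr0n.
have rec i : (i < M)%N -> (geom_poly M ^+ n.+1)`_i =
    (geom_poly M ^+ n)`_i + (if i is j.+1 then lambda * (geom_poly M ^+ n.+1)`_j else 0).
  move=> iM; have /(congr1 (fun p : {poly R} => p`_i)) :
      geom_poly M ^+ n.+1 - lambda *: ('X * geom_poly M ^+ n.+1) =
      geom_poly M ^+ n - lambda ^+ M *: ('X^M * geom_poly M ^+ n).
    transitivity ((1 - (lambda *: 'X)) * geom_poly M * geom_poly M ^+ n).
      by rewrite exprS -!mul_polyC; ring.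
    by rewrite geom_polyE exprZn -!mul_polyC; ring.
  rewrite !coefB !coefZ coefXM coefXnM iM mulr0 subr0 => /eqP; rewrite subr_eq => /eqP ->.
  by case: i {iM} => //=; rewrite mulr0.
elim: m mM => [|m ihm] mM; rewrite rec//.
  by rewrite ihn// !addn0 !bin0 addr0.
rewrite ihn// ihm ?(ltnW mM)// mulrnAr -exprS -mulrnDr.
by rewrite !addSn !addnS/= binS.
Qed.

Lemma coef_XsubCX n j : (('X - lambda%:P) ^+ n)`_j = (- lambda) ^+ (n - j) *+ 'C(n, j).
Proof.
rewrite addrC exprDn coef_sum.
under eq_bigr => i _ do rewrite coefMn -polyCN -polyC_exp coefCM coefXn.
have [jn|jn] := leqP j n.
  rewrite (bigD1 (Ordinal (jn : (j < n.+1)%N)))//= eqxx mulr1 big1 ?addr0// => i.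
  by rewrite -val_eqE/= eq_sym => /negbTE ->; rewrite mulr0 mul0rn.
rewrite bin_small// mulr0n big1// => i _.
by rewrite gtn_eqF ?mulr0 ?mul0rn// (leq_trans (ltn_ord i)).
Qed.

(** Cauchy product of the expansions of [(z - lambda) ^ n] and of
    [(1 - lambda z) ^ (- n)]. *)
Definition blaschke_coef n k : R := \sum_(j < k.+1)
  ((- lambda) ^+ (n - j) *+ 'C(n, j)) *
  (lambda ^+ (k - j) *+ 'C((n + (k - j)).-1, k - j)).

Definition blaschke_trunc n M : {poly R} := ('X - lambda%:P) ^+ n * geom_poly M ^+ n.

Lemma coef_blaschke_trunc n M k : (k < M)%N -> (blaschke_trunc n M)`_k = blaschke_coef n k.
Proof.
move=> kM; rewrite /blaschke_trunc coefM; apply: eq_bigr => j _.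
by rewrite coef_XsubCX coef_geom_polyX// (leq_ltn_trans (leq_subr _ _)).
Qed.

(** The error of the truncation is multiplicative, so it can be estimated on a
    whole circle at once. *)
Lemma blaschke_trunc_horner n M (z : R[i]) : 1 - lambda%:C * z != 0 ->
  (map_poly (real_complex R) (blaschke_trunc n M)).[z] =
  blaschke lambda z ^+ n * (1 - (lambda%:C * z) ^+ M) ^+ n.
Proof.
move=> z0.
have hg : (map_poly (real_complex R) (geom_poly M)).[z] =
    (1 - (lambda%:C * z) ^+ M) / (1 - lambda%:C * z).
  apply: (canRL (mulfK z0)).
  have /(congr1 (fun p => (map_poly (real_complex R) p).[z])) := geom_polyE M.
  rewrite !(rmorphM, rmorphB, rmorphXn)/= !(rmorph1, map_polyZ)/= map_polyX.
  by rewrite !hornerE => <-; ring.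
rewrite /blaschke_trunc !(rmorphM, rmorphXn)/= hornerM !horner_exp hg.
rewrite rmorphB/= map_polyX map_polyC/=.
by rewrite hornerXsubC /blaschke !expr_div_n; field; rewrite expf_neq0.
Qed.

Lemma normc_expn1B n (y : R[i]) (e : R) : normc y <= e -> e <= 1 ->
  normc ((1 - y) ^+ n - 1) <= (2 ^+ n - 1) * e.
Proof.
move=> ye e1; elim: n => [|n ih]; first by rewrite !expr0 !subrr normc0 mul0r.
have -> : (1 - y) ^+ n.+1 - 1 = (1 - y) * ((1 - y) ^+ n - 1) - y by rewrite exprS; ring.
apply: le_trans (le_normcB _ _) _; rewrite normcM.
have h2 : normc (1 - y) <= 2.
  apply: le_trans (le_normcB _ _) _; rewrite normc1; lra.
have h : normc (1 - y) * normc ((1 - y) ^+ n - 1) <= 2 * ((2 ^+ n - 1) * e).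
  by rewrite ler_pM ?normc_ge0.
rewrite exprS; lra.
Qed.

Section Contour.
Variable rho : R.
Hypotheses (lambda01 : 0 < lambda < 1) (rho0 : rho != 0) (rho_lt : lambda * `|rho| < 1).

Let z (t : R) : R[i] := rho%:C * expi t.

Let normc_z t : normc (z t) = `|rho|.
Proof. by rewrite normcM normc_expi normc_real mulr1. Qed.

Let l0 : 0 <= lambda. Proof. by case/andP: lambda01 => /ltW. Qed.

Let normc_lz t : normc (lambda%:C * z t) = lambda * `|rho|.
Proof. by rewrite normcM normc_z normc_real ger0_norm. Qed.

Let den_ge t : 1 - lambda * `|rho| <= normc (1 - lambda%:C * z t).
Proof.
have := @le_normcD R (1 - lambda%:C * z t) (lambda%:C * z t).
by rewrite subrK normc1 normc_lz; lra.
Qed.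

Lemma den_neq0 t : 1 - lambda%:C * z t != 0.
Proof.
apply/eqP => h; have := den_ge t; rewrite h normc0.
by have := rho_lt; lra.
Qed.

Lemma z_neq0 t : z t != 0.
Proof. by rewrite mulf_neq0 ?expi_neq0// fmorph_eq0. Qed.

Let cz : ccontinuous z.
Proof. by apply: ccontinuousM; [exact: ccontinuous_cst|exact: ccontinuous_expi]. Qed.

Lemma ccontinuous_blaschke n k :
  ccontinuous (fun t => blaschke lambda (z t) ^+ n * z t ^- k).
Proof.
apply: ccontinuousM.
  apply: ccontinuousX; apply: ccontinuousM.
    by apply: ccontinuousB => //; exact: ccontinuous_cst.
  apply: ccontinuousV; last exact: den_neq0.
  apply: ccontinuousB; first exact: ccontinuous_cst.
  by apply: ccontinuousM => //; exact: ccontinuous_cst.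
apply: ccontinuousV; first exact: ccontinuousX.
by move=> t; rewrite expf_neq0// z_neq0.
Qed.

Lemma normc_blaschke_le t :
  normc (blaschke lambda (z t)) <= (`|rho| + lambda) / (1 - lambda * `|rho|).
Proof.
have h : 0 < 1 - lambda * `|rho| by rewrite subr_gt0.
rewrite /blaschke normcM normcV ler_pM ?invr_ge0 ?normc_ge0//.
  by apply: le_trans (le_normcB _ _) _; rewrite normc_z normc_real (ger0_norm l0).
by rewrite lef_pV2 ?den_ge// posrE (lt_le_trans h)// den_ge.
Qed.

(** The two sides differ by at most [C * (lambda |rho|) ^ M] for every large [M]:
    the left side is compared with the integral of the truncation of order [M],
    which [circle_int_poly] evaluates.  In particular the left side does not depend on
    [rho], so the circle can be moved to the critical point. *)
Lemma circle_int_blaschke n k :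
  circle_int (fun t => blaschke lambda (z t) ^+ n * z t ^- k) = (2 * pi * blaschke_coef n k)%:C.
Proof.
set F := (fun t => _).
pose B := ((`|rho| + lambda) / (1 - lambda * `|rho|)) ^+ n * `|rho| ^- k * 2 ^+ n.
have h M : (k < M)%N ->
    normc (circle_int F - (2 * pi * blaschke_coef n k)%:C) <= 4 * pi * (B * (lambda * `|rho|) ^+ M).
  move=> kM.
  rewrite -(coef_blaschke_trunc _ _ _ kM) -(circle_int_poly _ _ _ rho0).
  have cG : ccontinuous (fun t =>
      (map_poly (real_complex R) (blaschke_trunc n M)).[z t] * z t ^- k).
    rewrite (_ : (fun _ => _) = fun t => F t * (1 - (lambda%:C * z t) ^+ M) ^+ n).
      apply: ccontinuousM; first exact: ccontinuous_blaschke.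
      apply: ccontinuousX; apply: ccontinuousB; first exact: ccontinuous_cst.
      by apply: ccontinuousX; apply: ccontinuousM => //; exact: ccontinuous_cst.
    by apply/funext => t; rewrite blaschke_trunc_horner ?den_neq0// /F; ring.
  rewrite -[X in _ - X]mul1r -mulNr -circle_intZ// -circle_intD//; first last.
  - by apply: ccontinuousM => //; exact: ccontinuous_cst.
  - exact: ccontinuous_blaschke.
  apply: normc_circle_int_le.
    apply: ccontinuousD; first exact: ccontinuous_blaschke.
    by apply: ccontinuousM => //; exact: ccontinuous_cst.
  move=> t; rewrite blaschke_trunc_horner ?den_neq0//.
  set b := blaschke _ _; set y := (_ * _) ^+ M.
  have -> : F t + -1 * (b ^+ n * (1 - y) ^+ n * z t ^- k) =
     - (b ^+ n * z t ^- k * ((1 - y) ^+ n - 1)) by rewrite /F -/b; ring.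
  rewrite normcN !normcM normcX normcV normcX normc_z /B -!mulrA.
  have ny : normc y = (lambda * `|rho|) ^+ M by rewrite normcX normc_lz.
  have lr0 : 0 <= lambda * `|rho| by rewrite mulr_ge0.
  apply: ler_pM; rewrite ?mulr_ge0 ?invr_ge0 ?exprn_ge0 ?normc_ge0//.
    have nb := normc_blaschke_le t.
    by rewrite lerXn2r ?nnegrE ?normc_ge0// (le_trans _ nb) ?normc_ge0.
  rewrite ler_wpM2l ?invr_ge0 ?exprn_ge0//.
  apply: le_trans (normc_expn1B _ _ _ (lexx _) _) _.
    by rewrite ny exprn_ile1// ltW.
  by rewrite ny ler_wpM2r ?exprn_ge0// lerBlDr lerDl.
apply/eqP; rewrite -subr_eq0; apply/eqP/eq0_normc.
apply/le_anti/andP; split; last exact: normc_ge0.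
have : 4 * pi * (B * (lambda * `|rho|) ^+ M) @[M --> \oo] --> 4 * pi * (B * 0).
  apply: cvgM; first exact: cvg_cst.
  apply: cvgM; first exact: cvg_cst.
  by apply: cvg_expr; rewrite ger0_norm// mulr_ge0.
rewrite !mulr0 => hc; apply: (ler_cvg_to (cvg_cst _) hc).
by exists k.+1 => // M /= kM; exact: h.
Qed.

End Contour.

Lemma fourier_coefE n k : 0 < lambda < 1 -> fourier_coef lambda n k = (blaschke_coef n k)%:C.
Proof.
move=> l01; have pi0 : pi != 0 :> R by rewrite gt_eqF// pi_gt0.
have [l0 l1] := andP l01.
have h1 : lambda * `|1| < 1 by rewrite normr1 mulr1.
have -> : fourier_coef lambda n k = (2 * 'i * pi%:C)^-1 * ('i *
    circle_int (fun t => blaschke lambda (1%:C * expi t) ^+ n * (1%:C * expi t) ^- k)).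
  rewrite /fourier_coef; congr (_ * _).
  rewrite -circle_intZ; last exact: ccontinuous_blaschke.
  rewrite /circle_integral; apply: eq_circle_int => t; rewrite !mul1r.
  move: (_ * expi t ^- k) => A.
  by rewrite mulrCA divfK ?expi_neq0.
rewrite circle_int_blaschke ?oner_neq0//.
have i0 : 'i != 0 :> R[i] by rewrite eq_complex/= oner_eq0 andbF.
have pc0 : pi%:C != 0 :> R[i] by rewrite fmorph_eq0.
rewrite !rmorphM/= rmorph_nat; move: pc0; move: (real_complex R pi) => P pc0.
by field; rewrite i0 pc0.
Qed.

End Coef.

(** * The integrand near and away from the critical point *)

Section LocalFactor.
Context {R : realType} (p q K : R).
Hypotheses (K_ge1 : 1 <= K) (x_gt0 : 0 < p + q) (q_le : `|q| <= K * (p + q)).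
Let x := p + q.

(** The integrand on the critical circle, normalised to 1 at the critical point
    and to the power [1 / n]. *)
Definition local_factor (t : R) : R[i] :=
  (1 + p%:C * (expi t - 1)) / (1 - q%:C * (expi t - 1)) * expi (- (p + q) * t).
(** Minus the second derivative of [log local_factor] at 0. *)
Definition local_var : R := p * (1 - p) + q * (1 + q).

Lemma sqr_normc_num t :
  normc (1 + p%:C * (expi t - 1)) ^+ 2 = 1 - 2 * (p * (1 - p)) * (1 - cos t).
Proof.
have := sin2cos2 t; rewrite sqr_normcE/= !(mul0r, subr0, add0r, addr0, oppr0).
by move: (cos t) (sin t) => c s h; ring: h.
Qed.

Lemma sqr_normc_den t :
  normc (1 - q%:C * (expi t - 1)) ^+ 2 = 1 + 2 * (q * (1 + q)) * (1 - cos t).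
Proof.
have := sin2cos2 t; rewrite sqr_normcE/= !(mul0r, subr0, add0r, addr0, oppr0, sub0r).
by move: (cos t) (sin t) => c s h; ring: h.
Qed.

(* The numerator of [local_factor t - (1 - local_var * t ^ 2 / 2)], up to a factor
   of modulus 1. *)
Let N t : R[i] := 1 + p%:C * (expi t - 1) -
  (1 - q%:C * (expi t - 1)) * (1 - (local_var * t ^+ 2 / 2)%:C) * expi (x * t).

(** In the identity [NE] of the proof, the terms of order 0, 1 and 2 in [t] cancel:
    order 1 because the frequency of the exponential is [p + q], order 2 by the
    value of [local_var].  Every remaining term is a Taylor remainder of [expi t]
    or [expi (x t)] times powers of [x], and [q] and [local_var] are bounded in
    terms of [x]. *)
Lemma local_factor_num t : 0 <= local_var ->
  normc (N t) <= 10 * (1 + K) ^+ 2 * (x + x ^+ 3) * `|t| ^+ 3.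
Proof.
move=> v0.
pose E : R[i] := expi t - 1; pose X : R[i] := expi (x * t) - 1.
pose ei : R[i] := 'i * t%:C; pose xi : R[i] := 'i * (x * t)%:C.
have x0 : 0 < x by [].
have NE : N t = x%:C * (E - ei + (t ^+ 2 / 2)%:C) - (X - xi + ((x * t) ^+ 2 / 2)%:C)
   + q%:C * (E - ei) * X + q%:C * ei * (X - xi)
   + (local_var * t ^+ 2 / 2)%:C * (X - q%:C * E * expi (x * t)).
  rewrite /N /E /X /ei /xi /local_var /x.
  rewrite !(rmorphM, rmorphD, rmorphB, rmorphXn, rmorph1, fmorphV, rmorph_nat)/=.
  have i2 : 'i ^+ 2 = -1 :> R[i] by exact: sqr_i.
  move: (expi t) (expi _) i2 => e1 e2 i2.
  by field: i2.
have bE : normc E <= 2 * `|t| by exact: expi_taylor0.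
have bE1 : normc (E - ei) <= 2 * `|t| ^+ 2 by exact: expi_taylor1.
have bE2 : normc (E - ei + (t ^+ 2 / 2)%:C) <= `|t| ^+ 3 by exact: expi_taylor2.
have nx : `|x * t| = x * `|t| by rewrite normrM gtr0_norm.
have bX : normc X <= 2 * (x * `|t|) by rewrite -nx; exact: expi_taylor0.
have bX1 : normc (X - xi) <= 2 * (x * `|t|) ^+ 2 by rewrite -nx; exact: expi_taylor1.
have bX2 : normc (X - xi + ((x * t) ^+ 2 / 2)%:C) <= (x * `|t|) ^+ 3.
  by rewrite -nx; exact: expi_taylor2.
have nei : normc ei = `|t|.
  by rewrite normcM normc_real normc_ReIm/= expr0n/= add0r expr1n sqrtr1 mul1r.
have eX : normc (expi (x * t)) = 1 by exact: normc_expi.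
clearbody E X ei xi.
have t0 := normr_ge0 t; have q0 := normr_ge0 q.
have T3 (a b c d e : R[i]) : normc (a - b + c + d + e) <=
    normc a + normc b + normc c + normc d + normc e.
  apply: le_trans (le_normcD _ _) _; rewrite lerD2r.
  apply: le_trans (le_normcD _ _) _; rewrite lerD2r.
  by apply: le_trans (le_normcD _ _) _; rewrite lerD2r le_normcB.
have vle : local_var <= x + 2 * K * x ^+ 2.
  have -> : local_var = x - x ^+ 2 + 2 * q * x by rewrite /local_var /x; ring.
  have : q * x <= K * x * x by rewrite ler_wpM2r ?(ltW x0)// (le_trans (ler_norm _)).
  have := sqr_ge0 x; nra.
apply: (@le_trans _ _ (x * `|t| ^+ 3 + (x * `|t|) ^+ 3 + `|q| * (2 * `|t| ^+ 2) * (2 * (x * `|t|))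
  + `|q| * `|t| * (2 * (x * `|t|) ^+ 2)
  + local_var * `|t| ^+ 2 / 2 * (2 * (x * `|t|) + `|q| * (2 * `|t|)))).
  rewrite NE; apply: le_trans (T3 _ _ _ _ _) _.
  rewrite !normcM nei !normc_real (gtr0_norm x0).
  apply: lerD; [apply: lerD; [apply: lerD; [apply: lerD|]|]|].
  - by rewrite ler_pM2l.
  - exact: bX2.
  - by apply: ler_pM; rewrite ?mulr_ge0 ?normc_ge0// ler_wpM2l.
  - by apply: ler_pM; rewrite ?mulr_ge0 ?normc_ge0.
  - have -> : `|local_var * t ^+ 2 / 2| = local_var * `|t| ^+ 2 / 2.
      rewrite real_normK ?num_real// ger0_norm// divr_ge0//.
      by apply: mulr_ge0 => //; exact: sqr_ge0.
    apply: ler_wpM2l; first by rewrite divr_ge0// mulr_ge0// exprn_ge0.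
    apply: le_trans (le_normcB _ _) _; rewrite lerD//.
    by rewrite !normcM normc_expi mulr1 normc_real ler_wpM2l.
have -> : x * `|t| ^+ 3 + (x * `|t|) ^+ 3 + `|q| * (2 * `|t| ^+ 2) * (2 * (x * `|t|))
  + `|q| * `|t| * (2 * (x * `|t|) ^+ 2)
  + local_var * `|t| ^+ 2 / 2 * (2 * (x * `|t|) + `|q| * (2 * `|t|)) =
  (x + x ^+ 3 + 4 * `|q| * x + 2 * `|q| * x ^+ 2 + local_var * (x + `|q|)) * `|t| ^+ 3 by field.
rewrite ler_wpM2r ?exprn_ge0//.
have x2 : x ^+ 2 <= x + x ^+ 3.
  have : 0 <= x * (x - 1) ^+ 2 by rewrite mulr_ge0 ?sqr_ge0// ltW.
  have := sqr_ge0 x; nra.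
have h1 : `|q| * x <= K * x ^+ 2 by rewrite (expr2 x) mulrA; exact: (ler_wpM2r (ltW x0)).
have h2 : `|q| * x ^+ 2 <= K * x ^+ 3 by rewrite (exprS x 2) mulrA; exact: (ler_wpM2r (sqr_ge0 x)).
have h3 : local_var * (x + `|q|) <= (x + 2 * K * x ^+ 2) * ((1 + K) * x).
  apply: ler_pM => //; first by rewrite addr_ge0// ltW.
  by rewrite mulrDl mul1r lerD2l.
have x3 : 0 <= x ^+ 3 by rewrite exprn_ge0// ltW.
apply: (@le_trans _ _ (x + (5 * K + 1) * x ^+ 2 + (1 + 4 * K + 2 * K ^+ 2) * x ^+ 3)).
  have -> : (x + (5 * K + 1) * x ^+ 2 + (1 + 4 * K + 2 * K ^+ 2) * x ^+ 3) =
    x + x ^+ 3 + 4 * (K * x ^+ 2) + 2 * (K * x ^+ 3) + (x + 2 * K * x ^+ 2) * ((1 + K) * x) by ring.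
  lra.
have K0 : 0 <= K := le_trans ler01 K_ge1.
have : (5 * K + 1) * x ^+ 2 <= (5 * K + 1) * (x + x ^+ 3).
  by apply: ler_wpM2l => //; lra.
have : 0 <= K * x by rewrite mulr_ge0 ?(ltW x0).
have : 0 <= K * x ^+ 3 by rewrite mulr_ge0.
have : 0 <= K ^+ 2 * x by rewrite mulr_ge0 ?sqr_ge0// ltW.
have : 0 <= K ^+ 2 * x ^+ 3 by rewrite mulr_ge0 ?sqr_ge0//.
nra.
Qed.

Variables (c2 K1 : R).
Hypotheses (c2_gt0 : 0 < c2) (c2_le1 : c2 <= 1) (c2_le : c2 <= 1 + 2 * q).
Hypotheses (K1_ge0 : 0 <= K1) (K1_ge : - (p * (1 - p)) <= K1).

(** The squared modulus [1 + 2 q (1 + q) (1 - cos t)] is monotone in [cos t], so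
    it is at least the smaller of its values at [t = 0] and [t = pi], which are 1
    and [(1 + 2 q) ^ 2]. *)
Lemma normc_den_ge t : c2 <= normc (1 - q%:C * (expi t - 1)).
Proof.
have := sqr_normc_den t; have := cos_le1 t; have := cos_geN1 t.
move: (cos t) (normc _) (normc_ge0 (1 - q%:C * (expi t - 1))) => c n n0 c1 c3 e.
suff : c2 ^+ 2 <= n ^+ 2 by rewrite ler_pXn2r ?nnegrE// ltW.
rewrite e; have [q0|q0] := leP 0 (q * (1 + q)).
  have : 0 <= q * (1 + q) * (1 - c) by rewrite mulr_ge0//; lra.
  have : c2 ^+ 2 <= 1 by rewrite exprn_ile1// ltW.
  lra.
have : 0 <= - (q * (1 + q)) * (1 + c) by rewrite mulr_ge0//; lra.
have : c2 ^+ 2 <= (1 + 2 * q) ^+ 2.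
  by rewrite lerXn2r// nnegrE ?(le_trans _ c2_le)// ltW.
lra.
Qed.

Lemma ccontinuous_local_factor (s : R) : ccontinuous (fun u => local_factor (u / s)).
Proof.
have cE : ccontinuous (fun u => expi (u / s) - 1).
  apply: ccontinuousB; last exact: ccontinuous_cst.
  by under eq_fun do rewrite mulrC; exact: ccontinuous_expiM.
have cE' c : ccontinuous (fun u => c * (expi (u / s) - 1)).
  by apply: ccontinuousM => //; exact: ccontinuous_cst.
apply: ccontinuousM; first apply: ccontinuousM.
- by apply: ccontinuousD => //; exact: ccontinuous_cst.
- apply: ccontinuousV; first by apply: ccontinuousB => //; exact: ccontinuous_cst.
  move=> u; apply/eqP => e.
  by have := normc_den_ge (u / s); rewrite e normc0; have := c2_gt0; lra.
- under eq_fun do rewrite [_ / _]mulrC mulrA; exact: ccontinuous_expiM.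
Qed.

Lemma local_factor_taylor t : 0 <= local_var ->
  normc (local_factor t - (1 - local_var * t ^+ 2 / 2)%:C) <=
  10 * (1 + K) ^+ 2 / c2 * (x + x ^+ 3) * `|t| ^+ 3.
Proof.
move=> v0; have h := normc_den_ge t.
have d0 : 1 - q%:C * (expi t - 1) != 0.
  by apply/eqP => e; move: h c2_gt0; rewrite e normc0; lra.
have -> : local_factor t - (1 - local_var * t ^+ 2 / 2)%:C =
    N t * expi (- x * t) * (1 - q%:C * (expi t - 1))^-1.
  rewrite /N /local_factor -/x mulNr -expiV.
  move: (1 - q%:C * _) d0 => d d0.
  by have := expi_neq0 (x * t); move: (expi (x * t)) => e e0; field; rewrite d0 e0.
rewrite !normcM normc_expi mulr1 normcV.
have -> : 10 * (1 + K) ^+ 2 / c2 * (x + x ^+ 3) * `|t| ^+ 3 =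
   (10 * (1 + K) ^+ 2 * (x + x ^+ 3) * `|t| ^+ 3) * c2^-1 by ring.
apply: ler_pM; rewrite ?invr_ge0 ?normc_ge0//; first exact: local_factor_num.
by rewrite lef_pV2 ?posrE// (lt_le_trans c2_gt0).
Qed.

(** By [sqr_normc_num] and [sqr_normc_den], with [a = p (1 - p)], [b = q (1 + q)]
    and [g = 1 - cos t], the squared modulus is [(1 - 2 a g) / (1 + 2 b g)], and
    [a + b = local_var]; the numerator is at most [1 + 4 K1]. *)
Lemma local_factor_decay t : 0 <= local_var ->
  normc (local_factor t) ^+ 2 * (1 + 2 * local_var * (1 - cos t) / (1 + 4 * K1)) <= 1.
Proof.
move=> v0; have h := normc_den_ge t.
have K0 : 0 < 1 + 4 * K1 by have := K1_ge0; lra.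
have d0 := lt_le_trans c2_gt0 h.
rewrite /local_factor !normcM normcV normc_expi mulr1 exprMn exprVn.
rewrite mulrAC ler_pdivrMr ?exprn_gt0// mul1r sqr_normc_den sqr_normc_num.
have := sqr_normc_num t; move: (normc _) => n en.
have := cos_le1 t; have := cos_geN1 t; move: (cos t) en => c en c1 c2'.
have v : local_var = p * (1 - p) + q * (1 + q) by [].
move: (p * (1 - p)) (q * (1 + q)) local_var K1_ge v0 en v => a b s ha s0 en v.
have g0 : 0 <= 1 - c by lra.
have hn : 1 - 2 * a * (1 - c) <= 1 + 4 * K1.
  have := K1_ge0; nra.
have : (1 - 2 * a * (1 - c)) / (1 + 4 * K1) <= 1 by rewrite ler_pdivrMr// mul1r.
have : 0 <= s * (1 - c) by rewrite mulr_ge0.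
have -> : (1 - 2 * a * (1 - c)) * (1 + 2 * s * (1 - c) / (1 + 4 * K1)) =
  1 - 2 * a * (1 - c) + 2 * (s * (1 - c)) * ((1 - 2 * a * (1 - c)) / (1 + 4 * K1)) by ring.
move: ((1 - 2 * a * (1 - c)) / (1 + 4 * K1)) => y sg y1.
have : s * (1 - c) * y <= s * (1 - c) by rewrite ler_piMr.
rewrite v; lra.
Qed.

End LocalFactor.

(** * Laplace's method *)

Section DCT.
Context {R : realType}.
Notation mu := (@lebesgue_measure R).

Lemma integrable_oneDsqrV (C : R) : 0 <= C ->
  mu.-integrable setT (EFin \o (fun u : R => C * (oneDsqr u)^-1)).
Proof.
move=> C0.
suff h : mu.-integrable setT (EFin \o (fun u : R => (oneDsqr u)^-1)).
  apply: eq_integrable (integrableZl measurableT C h) => //.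
have m : measurable_fun setT (fun u : R => (oneDsqr u)^-1).
  by apply: continuous_measurable_fun; exact: continuous_oneDsqrV.
apply/integrableP; split; first exact/measurable_EFinP.
under eq_integral do rewrite /= ger0_norm ?invr_ge0//.
rewrite ge0_symfun_integralT//.
- rewrite (_ : [set x | _] = `[0, +oo[%classic).
    by rewrite integral0y_oneDsqr -EFinM ltry.
  by apply/seteqP; split => x/=; rewrite in_itv/= andbT.
- exact: continuous_oneDsqrV.
- by move=> x /=; rewrite /oneDsqr sqrrN.
Qed.

(** The hypotheses hold only for large [n], while dominated convergence needs them
    for all [n]: the integrands of small index are replaced by 0. *)
Lemma gauss_dominated_cvg (F : nat -> R -> R) (tau : nat -> R) (C : R) :
  0 <= C ->
  (\forall n \near \oo, continuous (F n)) ->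
  (\forall n \near \oo, forall u, `|u| <= pi * tau n -> `|F n u| <= C * (oneDsqr u)^-1) ->
  (forall u, F n u @[n --> \oo] --> expR (- u ^+ 2)) ->
  tau n @[n --> \oo] --> +oo ->
  \int[mu]_(u in `[- (pi * tau n), pi * tau n]) F n u @[n --> \oo] --> Num.sqrt pi.
Proof.
move=> C0 [N1 _ Fc] [N2 _ FC] Fcvg tauy.
pose N := maxn N1 N2.
have cF n : (N <= n)%N -> continuous (F n).
  by move=> Nn; apply: Fc => /=; rewrite (leq_trans _ Nn)// leq_maxl.
have dF n : (N <= n)%N -> forall u, `|u| <= pi * tau n -> `|F n u| <= C * (oneDsqr u)^-1.
  by move=> Nn; apply: FC => /=; rewrite (leq_trans _ Nn)// leq_maxr.
pose A n : set R := `[- (pi * tau n), pi * tau n]%classic.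
pose f n : R -> \bar R := if (N <= n)%N then (EFin \o F n) \_ (A n) else cst 0%E.
have AE n u : (u \in A n) = (`|u| <= pi * tau n).
  by rewrite /A mem_setE in_itv/= ler_norml.
have [] := @dominated_convergence _ _ R mu setT measurableT f (EFin \o gauss_fun)
  (EFin \o (fun u : R => C * (oneDsqr u)^-1)).
- move=> n; rewrite /f; case: ifPn => [Nn|_]; last exact: measurable_cst.
  apply/measurable_restrict => //; first exact: measurable_itv.
  apply/measurable_EFinP; apply: measurable_funTS.
  by apply: continuous_measurable_fun; exact: cF.
- by apply/measurable_EFinP; exact: measurable_gauss_fun.
- apply: aeW => u _.
  have h : (EFin \o (fun n => F n u)) n @[n --> \oo] --> (expR (- u ^+ 2))%:E.
    by apply: cvg_EFin; [exact: nearW|exact: Fcvg].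
  apply: cvg_trans h; apply: near_eq_cvg; near=> n.
  rewrite /f ifT; last by near: n; exact: nbhs_infty_ge.
  rewrite patchE AE ifT//.
  rewrite -ler_pdivrMl ?pi_gt0//; near: n.
  by move/cvgryPge : tauy; apply.
- exact: integrable_oneDsqrV.
- apply: aeW => u n _; rewrite /f; case: ifPn => [Nn|_]; last first.
    by rewrite /= normr0 lee_fin mulr_ge0// invr_ge0.
  rewrite patchE AE; case: ifPn => [un|_]; first by rewrite /= lee_fin dF.
  by rewrite /= normr0 lee_fin mulr_ge0// invr_ge0.
move=> _ _; rewrite integralT_gauss => h.
apply: cvg_trans (fine_cvg h); apply: near_eq_cvg; near=> n.
rewrite /= /Rintegral /f ifT; last by near: n; exact: nbhs_infty_ge.
by rewrite -integral_mkcond.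
Unshelve. all: by end_near. Qed.

Lemma Rintegral_affine (g : R -> R) (tau : R) : 0 < tau -> continuous g ->
  \int[mu]_(t in `[0, 2 * pi]) g t =
  tau^-1 * \int[mu]_(u in `[- (pi * tau), pi * tau]) g (pi + u / tau).
Proof.
move=> tau0 cg.
pose F u := pi + u / tau.
have F0 : F (- (pi * tau)) = 0 by rewrite /F; field; rewrite gt_eqF.
have F1 : F (pi * tau) = 2 * pi.
  by rewrite /F; field; rewrite gt_eqF.
have dF (u : R) : is_derive u 1 F tau^-1.
  by apply: is_derive_eq; rewrite /GRing.scale/=; field; rewrite gt_eqF.
have dFE : derive1 F = cst tau^-1.
  by apply/funext => u; rewrite derive1E; apply: derive_val.
have cF : continuous F.
  by move=> u; apply: cvgD; [exact: cvg_cst|apply: cvgM; [exact: cvg_id|exact: cvg_cst]].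
have ab : - (pi * tau) <= pi * tau.
  by rewrite -subr_ge0 opprK addr_ge0// mulr_ge0 ?pi_ge0// ltW.
have cgF : continuous (fun u => g (F u)).
  by move=> u; apply: continuous_comp; [exact: cF|exact: cg].
rewrite -RintegralZl//; last exact: continuous_integrable.
have -> : \int[mu]_(t in `[0, 2 * pi]) g t =
    fine (\int[mu]_(t in `[F (- (pi * tau))%R, F (pi * tau)%R]) (g t)%:E)%E.
  by rewrite F0 F1.
rewrite (integration_by_substitution_increasing ab).
- congr fine; apply: eq_integral => u _.
  by rewrite /= dFE mulrC.
- by move=> u v _ _ uv; rewrite /F ltrD2l ltr_pM2r// invr_gt0.
- by rewrite dFE => u _; exact: cvg_cst.
- by rewrite dFE; apply/cvg_ex; exists tau^-1; exact: cvg_cst.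
- by rewrite dFE; apply/cvg_ex; exists tau^-1; exact: cvg_cst.
- split; first by move=> t _; exact: ex_derive.
    exact: cvg_at_right_filter (cF _).
  exact: cvg_at_left_filter (cF _).
- exact: continuous_subspaceT.
Qed.

End DCT.

Section LocalGauss.
Context {R : realType} (K c2 K1 : R) (p q : nat -> R).
Hypotheses (K_ge1 : 1 <= K) (c2_gt0 : 0 < c2) (c2_le1 : c2 <= 1) (K1_ge0 : 0 <= K1).
Notation mu := (@lebesgue_measure R).

Let x n := p n + q n.
Let v n := local_var (p n) (q n).
(** The scale at which [n * local_var * theta ^ 2 / 2] becomes [u ^ 2]. *)
Definition gauss_scale n : R := Num.sqrt (n%:R * local_var (p n) (q n) / 2).
Let tau := gauss_scale.

(** What the local estimates need to know about [p] and [q], with constants that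
    will only depend on [lambda]. *)
Definition admissible_pq (a b : R) :=
  [/\ 0 < a + b, `|b| <= K * (a + b), 0 < local_var a b, c2 <= 1 + 2 * b
    & - (a * (1 - a)) <= K1].

Lemma sqr_gauss_scale n : 0 < v n -> tau n ^+ 2 = n%:R * v n / 2.
Proof. by move=> v0; rewrite sqr_sqrtr// divr_ge0// mulr_ge0// ltW. Qed.

Lemma gauss_scale_gt0 n : (0 < n)%N -> 0 < v n -> 0 < tau n.
Proof. by move=> n0 v0; rewrite sqrtr_gt0 divr_gt0// mulr_gt0// ltr0n. Qed.

Lemma local_factor_le1 n t : admissible_pq (p n) (q n) ->
  normc (local_factor (p n) (q n) t) <= 1.
Proof.
case=> x0 qK v0 c2q K1p.
have := local_factor_decay (p n) (q n) _ _ c2_gt0 c2_le1 c2q K1_ge0 K1p t (ltW v0).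
have : 0 <= 2 * local_var (p n) (q n) * (1 - cos t) / (1 + 4 * K1).
  rewrite divr_ge0 ?mulr_ge0 ?(ltW v0) ?subr_ge0 ?cos_le1//.
  by have := K1_ge0; lra.
move: (normc _) (normc_ge0 (local_factor (p n) (q n) t)) => w w0.
move: (_ / _) => y y0 h.
have : w ^+ 2 <= 1 by apply: le_trans h; rewrite ler_peMr ?sqr_ge0// lerDl.
by rewrite expr_le1.
Qed.

(** With [theta = u / tau], the decay estimate reads [|w| ^ 2 <= 1 / (1 + a)] where
    [n * a] is a multiple of [u ^ 2]. *)
Lemma local_factor_dominated n u : (2 <= n)%N -> admissible_pq (p n) (q n) ->
  `|u| <= pi * tau n ->
  `|complex.Re (local_factor (p n) (q n) (u / tau n) ^+ n)| <=
  (27 * (1 + 4 * K1)) * (oneDsqr u)^-1.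
Proof.
move=> n2 adm utau; have [x0 qK v0 c2q K1p] := adm.
have n0 : (0 < n)%N by exact: leq_trans n2.
have t0 := gauss_scale_gt0 _ n0 v0.
apply: le_trans (Re_le_normc _) _; rewrite normcX.
have := local_factor_decay (p n) (q n) _ _ c2_gt0 c2_le1 c2q K1_ge0 K1p (u / tau n) (ltW v0).
have := normc_ge0 (local_factor (p n) (q n) (u / tau n)).
move: (normc _) => w w0.
have K0 : 0 < 1 + 4 * K1 by have := K1_ge0; lra.
have nR : 0 < n%:R :> R by rewrite ltr0n.
(* [cos_quadratic_gap] gives
   [2 * local_var * (1 - cos theta) >= 2 * u ^ 2 / (9 * n)]. *)
set a := 2 * u ^+ 2 / (9 * n%:R * (1 + 4 * K1)) => h.
have a0 : 0 <= a.
  apply: divr_ge0; first by rewrite mulr_ge0// sqr_ge0.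
  by rewrite !mulr_ge0// ltW.
have ale : a <= 2 * local_var (p n) (q n) * (1 - cos (u / tau n)) / (1 + 4 * K1).
  have -> : a = 2 * local_var (p n) (q n) * ((u / tau n) ^+ 2 / 18) / (1 + 4 * K1).
    rewrite expr_div_n (sqr_gauss_scale _ v0) /a /v; field.
    by rewrite !gt_eqF.
  rewrite ler_pM2r ?invr_gt0// ler_pM2l ?mulr_gt0//.
  by apply: cos_quadratic_gap; rewrite normrM normfV (gtr0_norm t0) ler_pdivrMr.
have wa : w ^+ 2 * (1 + a) <= 1.
  by apply: le_trans h; rewrite ler_wpM2l ?sqr_ge0// lerD2l.
have wn : (w ^+ n * (1 + n%:R * a / 3)) ^+ 2 <= 1.
  rewrite exprMn exprAC; apply: (@le_trans _ _ ((w ^+ 2) ^+ n * (1 + a) ^+ n)).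
    by rewrite ler_wpM2l ?exprn_ge0 ?sqr_ge0// exprn_ge_sqr.
  by rewrite -exprMn exprn_ile1// mulr_ge0 ?sqr_ge0//; lra.
have na0 : 0 <= n%:R * a / 3 by rewrite divr_ge0// mulr_ge0.
have {}wn : w ^+ n * (1 + n%:R * a / 3) <= 1.
  by rewrite -(@expr_le1 _ 2)// mulr_ge0 ?exprn_ge0//; lra.
have od : 0 < oneDsqr u by rewrite (lt_le_trans ltr01).
rewrite ler_pdivlMr//.
apply: (@le_trans _ _ (w ^+ n * (27 * (1 + 4 * K1) * (1 + n%:R * a / 3)))).
  rewrite ler_wpM2l ?exprn_ge0//.
  have -> : 27 * (1 + 4 * K1) * (1 + n%:R * a / 3) = 27 * (1 + 4 * K1) + 2 * u ^+ 2.
    by rewrite /a; field; rewrite !gt_eqF.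
  by rewrite /oneDsqr; have := sqr_ge0 u; have := K1_ge0; lra.
rewrite mulrCA -[leRHS]mulr1 ler_pM2l//; lra.
Qed.

Hypothesis adm : \forall n \near \oo, admissible_pq (p n) (q n).
Hypothesis err : n%:R * (x n + x n ^+ 3) / tau n ^+ 3 @[n --> \oo] --> (0 : R).

(** [tau ^ 2] is at most a constant times [n (x + x ^ 3)], so [1 / tau] is at most
    a constant times the error term. *)
Lemma gauss_scale_cvgy : tau n @[n --> \oo] --> +oo.
Proof.
have inv0 : (tau n)^-1 @[n --> \oo] --> (0 : R).
  have h : (1 + 2 * K) / 2 * (n%:R * (x n + x n ^+ 3) / tau n ^+ 3)
      @[n --> \oo] --> ((1 + 2 * K) / 2 * 0 : R).
    by apply: cvgM => //; exact: cvg_cst.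
  rewrite mulr0 in h.
  apply: (squeeze_cvgr _ (cvg_cst 0) h).
  near=> n.
  have [x0 qK v0 c2q K1p] : admissible_pq (p n) (q n) by near: n.
  have n0 : (0 < n)%N by near: n; exact: nbhs_infty_gt.
  have t0 := gauss_scale_gt0 _ n0 v0.
  rewrite invr_ge0 (ltW t0)/=.
  have -> : (tau n)^-1 = tau n ^+ 2 / tau n ^+ 3 by field; rewrite gt_eqF.
  rewrite mulrA ler_pM2r ?invr_gt0 ?exprn_gt0// (sqr_gauss_scale _ v0).
  have -> : (1 + 2 * K) / 2 * (n%:R * (x n + x n ^+ 3)) =
     n%:R * ((1 + 2 * K) * (x n + x n ^+ 3)) / 2 by field.
  rewrite ler_pM2r// ler_pM2l ?ltr0n//.
  have : q n * x n <= K * x n * x n.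
    by rewrite ler_wpM2r ?(ltW x0)// (le_trans (ler_norm _)).
  have -> : v n = x n - x n ^+ 2 + 2 * (q n * x n) by rewrite /v /local_var /x; ring.
  have : 0 <= x n * (x n - 1) ^+ 2 by rewrite mulr_ge0 ?sqr_ge0// ltW.
  have : 0 <= K * (x n * (x n - 1) ^+ 2).
    by rewrite mulr_ge0 ?(le_trans ler01 K_ge1)// mulr_ge0 ?sqr_ge0// ltW.
  have : 0 <= x n ^+ 3 by rewrite exprn_ge0// ltW.
  have : 0 <= K * x n ^+ 3 by rewrite mulr_ge0 ?(le_trans ler01 K_ge1)// exprn_ge0// ltW.
  have : 0 <= K * x n by rewrite mulr_ge0 ?(le_trans ler01 K_ge1)// ltW.
  have := sqr_ge0 (x n).
  lra.
apply/gtr0_cvgV0 => //.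
near=> n.
have [x0 qK v0 c2q K1p] : admissible_pq (p n) (q n) by near: n.
by rewrite gauss_scale_gt0//; near: n; exact: nbhs_infty_gt.
Unshelve. all: by end_near. Qed.

(** Both [w] and [e = exp (- u ^ 2 / n)] are close to [1 - u ^ 2 / n], up to the
    error term over [n], resp. [u ^ 4 / n ^ 2]; taking [n]-th powers multiplies
    the distance by [n] at most. *)
Lemma local_factor_cvg u :
  complex.Re (local_factor (p n) (q n) (u / tau n) ^+ n) @[n --> \oo] --> expR (- u ^+ 2).
Proof.
pose C3 := 10 * (1 + K) ^+ 2 / c2.
have h : C3 * `|u| ^+ 3 * (n%:R * (x n + x n ^+ 3) / tau n ^+ 3) + u ^+ 4 / n%:R
      @[n --> \oo] --> (C3 * `|u| ^+ 3 * 0 + u ^+ 4 * 0 : R).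
  apply: cvgD; first by apply: cvgM => //; exact: cvg_cst.
  apply: cvgM; first exact: cvg_cst.
  by rewrite -cvg_shiftS; exact: cvg_harmonic.
rewrite !mulr0 addr0 in h.
have hN : - (C3 * `|u| ^+ 3 * (n%:R * (x n + x n ^+ 3) / tau n ^+ 3) + u ^+ 4 / n%:R)
      @[n --> \oo] --> (0 : R) by rewrite -oppr0; exact: cvgN.
apply/subr_cvg0; apply: (squeeze_cvgr _ hN h).
near=> n.
have ad : admissible_pq (p n) (q n) by near: n.
have [x0 qK v0 c2q K1p] := ad.
have n0 : (0 < n)%N by near: n; exact: nbhs_infty_gt.
have t0 := gauss_scale_gt0 _ n0 v0.
have nR : 0 < n%:R :> R by rewrite ltr0n.
rewrite -ler_norml.
set w := local_factor (p n) (q n) (u / tau n).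
pose y := u ^+ 2 / n%:R.
have y0 : 0 <= y by rewrite divr_ge0 ?sqr_ge0.
pose e : R[i] := (expR (- y))%:C.
have -> : expR (- u ^+ 2) = complex.Re (e ^+ n).
  rewrite /e -rmorphXn/= -expRM_natl; congr expR.
  by rewrite /y; field; rewrite gt_eqF.
have -> : complex.Re (w ^+ n) - complex.Re (e ^+ n) = complex.Re (w ^+ n - e ^+ n).
  by case: (w ^+ n) (e ^+ n) => ? ? [].
apply: le_trans (Re_le_normc _) _.
have e1 : normc e <= 1.
  by rewrite normc_real ger0_norm ?expR_ge0// -expR0 ler_expR oppr_le0.
apply: le_trans (normcX_sub _ _ _ (local_factor_le1 _ _ ad) e1) _.
have vy : local_var (p n) (q n) * (u / tau n) ^+ 2 / 2 = y.
  rewrite expr_div_n (sqr_gauss_scale _ v0) /y /v; field.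
  by rewrite !gt_eqF.
have h1 := local_factor_taylor (p n) (q n) K K_ge1 x0 qK c2 c2_gt0 c2_le1 c2q (u / tau n) (ltW v0).
rewrite vy -/w in h1.
have h2 : normc ((1 - y)%:C - e) <= y ^+ 2.
  have -> : (1 - y)%:C - e = (1 - y - expR (- y))%:C by rewrite /e [RHS]rmorphB.
  by rewrite normc_real distrC expRN_bound.
apply: (@le_trans _ _ (n%:R * (10 * (1 + K) ^+ 2 / c2 * (p n + q n + (p n + q n) ^+ 3)
     * `|u / tau n| ^+ 3 + y ^+ 2))).
  rewrite ler_pM2l//.
  have -> : w - e = (w - (1 - y)%:C) + ((1 - y)%:C - e) by rewrite addrA subrK.
  by apply: le_trans (le_normcD _ _) _; rewrite lerD.
rewrite le_eqVlt; apply/orP; left; apply/eqP.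
rewrite normrM normfV (gtr0_norm t0) /y /C3 /x; field.
by rewrite !gt_eqF.
Unshelve. all: by end_near. Qed.

Theorem local_factor_gauss :
  \int[mu]_(u in `[- (pi * tau n), pi * tau n])
     complex.Re (local_factor (p n) (q n) (u / tau n) ^+ n) @[n --> \oo] --> Num.sqrt pi.
Proof.
apply: (@gauss_dominated_cvg R
  (fun n u => complex.Re (local_factor (p n) (q n) (u / tau n) ^+ n))
  tau (27 * (1 + 4 * K1))).
- by have := K1_ge0; lra.
- near=> n.
  have [x0 qK v0 c2q K1p] : admissible_pq (p n) (q n) by near: n.
  exact: (ccontinuousX _ n (ccontinuous_local_factor (p n) (q n) c2 c2_gt0 c2_le1 c2q (tau n))).1.
- near=> n => u hu; apply: (local_factor_dominated n u _ _ hu); near: n.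
    exact: (nbhs_infty_ge 2).
  exact: adm.
- exact: local_factor_cvg.
- exact: gauss_scale_cvgy.
Unshelve. all: by end_near. Qed.

End LocalGauss.

(** * The critical point *)

Section Saddle.
Context {R : realType} (lambda : R).
Hypothesis lambda01 : 0 < lambda < 1.
Implicit Types x rho : R.

Let l0 : 0 < lambda. Proof. by case/andP: lambda01. Qed.
Let l1 : lambda < 1. Proof. by case/andP: lambda01. Qed.

Definition rblaschke rho : R := (rho - lambda) / (1 - lambda * rho).

Lemma blaschke_real rho : blaschke lambda rho%:C = (rblaschke rho)%:C.
Proof. by rewrite /blaschke /rblaschke fmorph_div !rmorphB/= rmorphM rmorph1. Qed.

(** Up to a positive factor, the discriminant of the quadratic equation that
    defines [z_+]; it vanishes where the two critical points merge. *)
Definition saddle_disc x : R := (alpha0 lambda - x) * ((alpha0 lambda)^-1 - x).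
Definition saddle_range x := (0 < x < alpha0 lambda) \/ (alpha0 lambda)^-1 < x.
Definition saddle_dom rho := (-1 < rho < 0) \/ (1 < rho /\ lambda * rho < 1).
Definition saddle_p rho := rho / (rho - lambda).
Definition saddle_q rho := lambda * rho / (1 - lambda * rho).

Lemma alpha0_gt0 : 0 < alpha0 lambda.
Proof. by rewrite divr_gt0// ?subr_gt0// addr_gt0. Qed.

Lemma alpha0_lt1 : alpha0 lambda < 1.
Proof. by rewrite ltr_pdivrMr ?mul1r; have := l0; lra. Qed.

Lemma alpha0V_gt1 : 1 < (alpha0 lambda)^-1.
Proof. by rewrite invf_gt1 ?alpha0_gt0// alpha0_lt1. Qed.

Lemma saddle_range_gt0 x : saddle_range x -> 0 < x.
Proof.
by case=> [/andP[]//|]; apply: lt_trans; rewrite invr_gt0 alpha0_gt0.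
Qed.

Lemma saddle_disc_gt0 x : saddle_range x -> 0 < saddle_disc x.
Proof.
have a := alpha0_gt0; have b := alpha0_lt1; have c := alpha0V_gt1.
by case=> [/andP[x0 x1]|x1]; [rewrite mulr_gt0//; lra|rewrite nmulr_rgt0; lra].
Qed.

Lemma saddle_discE x : saddle_disc x = x ^+ 2 - 2 * (1 + lambda ^+ 2) / (1 - lambda ^+ 2) * x + 1.
Proof.
rewrite /saddle_disc /alpha0; field.
by apply/and3P; split; apply/eqP; have := l0; have := l1; nra.
Qed.

(* Half the sum of the two critical points [z_+] and [1 / z_+]. *)
Let cosaddle x := (x * (1 + lambda ^+ 2) - (1 - lambda ^+ 2)) / (2 * lambda * x).

Lemma sqrt_cosaddle x : saddle_range x ->
  Num.sqrt (cosaddle x ^+ 2 - 1) = (1 - lambda ^+ 2) * Num.sqrt (saddle_disc x) / (2 * lambda * x).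
Proof.
move=> xr; have x0 := saddle_range_gt0 _ xr.
have l2 : 0 < 1 - lambda ^+ 2 by have := l0; have := l1; nra.
have -> : cosaddle x ^+ 2 - 1 = ((1 - lambda ^+ 2) / (2 * lambda * x)) ^+ 2 * saddle_disc x.
  rewrite saddle_discE /cosaddle; field.
  by rewrite !gt_eqF//= ?mulr_gt0.
rewrite sqrtrM ?sqr_ge0// sqrtr_sqr ger0_norm; first by ring.
by rewrite divr_ge0 ?(ltW l2)// !mulr_ge0// ltW.
Qed.

Lemma sqrt_cosaddle_gt0 x : saddle_range x -> 0 < Num.sqrt (cosaddle x ^+ 2 - 1).
Proof.
move=> xr; have x0 := saddle_range_gt0 _ xr.
rewrite sqrt_cosaddle// divr_gt0 ?mulr_gt0 ?sqrtr_gt0 ?saddle_disc_gt0//.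
by have := l0; have := l1; nra.
Qed.

Lemma sqr_sqrt_cosaddle x : saddle_range x ->
  Num.sqrt (cosaddle x ^+ 2 - 1) ^+ 2 = cosaddle x ^+ 2 - 1.
Proof. by move=> xr; rewrite sqr_sqrtr// ltW// -sqrtr_gt0 sqrt_cosaddle_gt0. Qed.

Lemma cosaddleE x : saddle_range x ->
  cosaddle x * (2 * lambda * x) = x * (1 + lambda ^+ 2) - (1 - lambda ^+ 2).
Proof.
move=> /saddle_range_gt0 x0.
by rewrite /cosaddle divfK// !mulf_neq0 ?gt_eqF.
Qed.

(** The critical point equation [z b'(z) / b(z) = x] with denominators cleared. *)
Lemma zplus_quadratic x : saddle_range x ->
  zplus lambda x * (1 - lambda ^+ 2) =
  x * ((zplus lambda x - lambda) * (1 - lambda * zplus lambda x)).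
Proof.
move=> xr; have x0 := saddle_range_gt0 _ xr.
rewrite -[zplus lambda x]/(cosaddle x + Num.sqrt (cosaddle x ^+ 2 - 1)).
have := sqr_sqrt_cosaddle _ xr; have := cosaddleE _ xr.
move: (cosaddle x) (Num.sqrt _) => c s hc hs.
have e2 : (c + s) ^+ 2 = 2 * c * (c + s) - 1 by ring: hs.
have -> : x * ((c + s - lambda) * (1 - lambda * (c + s))) =
  (c + s) * (x * (1 + lambda ^+ 2)) - lambda * x * (c + s) ^+ 2 - lambda * x by ring.
have -> : x * (1 + lambda ^+ 2) = c * (2 * lambda * x) + (1 - lambda ^+ 2) by rewrite hc subrK.
rewrite e2; ring.
Qed.

Lemma zplus_left x : 0 < x < alpha0 lambda -> -1 < zplus lambda x < 0.
Proof.
move=> xa; have xr : saddle_range x by left.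
have x0 := saddle_range_gt0 _ xr; have s0 := sqrt_cosaddle_gt0 _ xr.
have ss := sqr_sqrt_cosaddle _ xr; have hc := cosaddleE _ xr.
rewrite -[zplus lambda x]/(cosaddle x + Num.sqrt (cosaddle x ^+ 2 - 1)).
have lx : 0 < lambda * x by rewrite mulr_gt0.
move: (cosaddle x) (Num.sqrt _) s0 ss hc => c s s0 ss hc.
have c1 : c < -1.
  move: xa => /andP[_]; rewrite /alpha0 ltr_pdivlMr ?addr_gt0// => xa.
  have := l0; nra.
apply/andP; split; nra.
Qed.

Lemma zplus_right x : (alpha0 lambda)^-1 < x ->
  1 < zplus lambda x /\ lambda * zplus lambda x < 1.
Proof.
move=> xa; have xr : saddle_range x by right.
have x0 := saddle_range_gt0 _ xr; have s0 := sqrt_cosaddle_gt0 _ xr.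
have quad := zplus_quadratic _ xr; have hc := cosaddleE _ xr.
have l2 : 0 < 1 - lambda ^+ 2 by have := l0; have := l1; nra.
have lx : 0 < lambda * x by rewrite mulr_gt0.
move: quad.
rewrite -[zplus lambda x]/(cosaddle x + Num.sqrt (cosaddle x ^+ 2 - 1)).
move: (cosaddle x) (Num.sqrt _) s0 hc => c s s0 hc quad.
have c1 : 1 < c.
  move: xa; rewrite /alpha0 invf_div ltr_pdivrMr ?subr_gt0// => xa.
  have := l1; nra.
have r1 : 1 < c + s by lra.
split => //; rewrite -subr_gt0.
(* In the saddle equation all other factors are positive. *)
have : 0 < x * ((c + s - lambda) * (1 - lambda * (c + s))).
  by rewrite -quad mulr_gt0//; lra.
by rewrite pmulr_rgt0// pmulr_rgt0//; have := l1; lra.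
Qed.

Lemma zplus_dom x : saddle_range x -> saddle_dom (zplus lambda x).
Proof. by case=> [/zplus_left|/zplus_right]; [left|right]. Qed.

Lemma saddle_dom_neq rho : saddle_dom rho ->
  [/\ rho != 0, rho - lambda != 0, 0 < 1 - lambda * rho & lambda * `|rho| < 1].
Proof.
case=> [/andP[r1 r0]|[r1 lr]].
  rewrite lt_eqF// subr_eq0 lt_eqF ?(lt_trans r0)//; split => //.
    by have := l0; nra.
  by rewrite ltr0_norm//; have := l0; have := l1; nra.
have r0 : 0 < rho by lra.
rewrite gt_eqF// subr_eq0 gt_eqF ?subr_gt0 ?gtr0_norm//.
by have := l1; lra.
Qed.

Lemma zplus_pq x : saddle_range x -> saddle_p (zplus lambda x) + saddle_q (zplus lambda x) = x.
Proof.
move=> xr; have [r0 rl rd _] := saddle_dom_neq _ (zplus_dom _ xr).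
have := zplus_quadratic _ xr; move: (zplus lambda x) r0 rl rd => r r0 rl rd quad.
have rd' : 1 - lambda * r != 0 by rewrite gt_eqF.
transitivity (r * (1 - lambda ^+ 2) / ((r - lambda) * (1 - lambda * r))).
  by rewrite /saddle_p /saddle_q; field; rewrite ?rl ?rd'.
by rewrite quad mulfK// mulf_neq0.
Qed.

(** [local_var = (p + q) (1 - p + q)], and [1 - p + q] is a multiple of
    [z_+ - 1 / z_+], the difference of the two roots, hence of the square root of
    the discriminant. *)
Lemma zplus_local_var x : saddle_range x ->
  local_var (saddle_p (zplus lambda x)) (saddle_q (zplus lambda x)) = x * Num.sqrt (saddle_disc x).
Proof.
move=> xr; have [r0 rl rd _] := saddle_dom_neq _ (zplus_dom _ xr).
have x0 := saddle_range_gt0 _ xr.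
have rd' : 1 - lambda * zplus lambda x != 0 by rewrite gt_eqF.
have l2 : 1 - lambda ^+ 2 != 0 by rewrite gt_eqF//; have := l0; have := l1; nra.
set r := zplus lambda x in r0 rl rd rd' *.
have quad : r * (1 - lambda ^+ 2) = x * ((r - lambda) * (1 - lambda * r)) := zplus_quadratic _ xr.
have hr : lambda * x * (r ^+ 2 - 1) = (1 - lambda ^+ 2) * Num.sqrt (saddle_disc x) * r.
  have -> : (1 - lambda ^+ 2) * Num.sqrt (saddle_disc x) =
      2 * lambda * x * Num.sqrt (cosaddle x ^+ 2 - 1).
    rewrite sqrt_cosaddle// mulrCA divff ?mulr1// !mulf_neq0 ?gt_eqF//.
  rewrite /r -[zplus lambda x]/(cosaddle x + Num.sqrt (cosaddle x ^+ 2 - 1)).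
  have := sqr_sqrt_cosaddle _ xr.
  move: (cosaddle x) (Num.sqrt _) => c s hs; ring: hs.
have -> : local_var (saddle_p r) (saddle_q r) =
   (saddle_p r + saddle_q r) * (lambda * (r ^+ 2 - 1) / ((r - lambda) * (1 - lambda * r))).
  by rewrite /local_var /saddle_p /saddle_q; field; rewrite ?rl ?rd'.
rewrite zplus_pq//; congr (_ * _).
have h : (r - lambda) * (1 - lambda * r) != 0 by rewrite mulf_neq0.
apply: (mulIf h); rewrite divfK//.
apply: (mulfI (lt0r_neq0 x0)).
have -> : x * (lambda * (r ^+ 2 - 1)) = lambda * x * (r ^+ 2 - 1) by ring.
rewrite hr (mulrCA x) -quad; ring.
Qed.

(** The bounds on [p] and [q] remain uniform when [z_+] tends to the pole
    [1 / lambda] of [b], that is, when [x] tends to infinity, because they are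
    relative to [x = p + q]. *)
Lemma saddle_admissible x : saddle_range x ->
  admissible_pq (1 - lambda)^-1 (alpha0 lambda) (lambda / (1 - lambda) ^+ 2)
    (saddle_p (zplus lambda x)) (saddle_q (zplus lambda x)).
Proof.
move=> xr; have x0 := saddle_range_gt0 _ xr.
have hv : 0 < x * Num.sqrt (saddle_disc x) by rewrite mulr_gt0// sqrtr_gt0 saddle_disc_gt0.
have pq := zplus_pq _ xr.
have vE := zplus_local_var _ xr.
have quad := zplus_quadratic _ xr.
have dom := zplus_dom _ xr.
have [r0 rl rd _] := saddle_dom_neq _ dom.
move: (zplus lambda x) pq vE quad dom r0 rl rd => r pq vE quad dom r0 rl rd.
have l1' : 0 < 1 - lambda by rewrite subr_gt0.
have hK1 : - (saddle_p r * (1 - saddle_p r)) = lambda * (r / (r - lambda) ^+ 2).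
  by rewrite /saddle_p; field.
have rl2 : 0 < (r - lambda) ^+ 2 by rewrite exprn_even_gt0.
rewrite /admissible_pq pq vE hK1.
have h2q : 1 + 2 * saddle_q r = (1 + lambda * r) / (1 - lambda * r).
  by rewrite /saddle_q; field; rewrite gt_eqF.
case: dom => [/andP[r1 rn]|[r1 lr]]; split => //.
- have qE : `|saddle_q r| = - lambda * r / (1 - lambda * r).
    rewrite ler0_norm ?mulNr// /saddle_q.
    by rewrite pmulr_lle0 ?invr_gt0// nmulr_lle0 ?ltW// .
  rewrite qE -[leRHS]mulrC ler_pdivlMr// mulrAC ler_pdivrMr//.
  have hx : x * (1 - lambda * r) = - r * (1 - lambda ^+ 2) / (lambda - r).
    have lr' : lambda - r != 0 by rewrite gt_eqF//; have := l0; lra.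
    by apply: (mulIf lr'); rewrite divfK//; lra.
  rewrite hx ler_pdivlMr; last by have := l0; lra.
  have : 0 <= - r * (1 - lambda) * ((1 + lambda) - lambda * (lambda - r)).
    rewrite !mulr_ge0 ?oppr_ge0 ?(ltW rn) ?(ltW l1')//.
    by have := l0; have := l1; nra.
  lra.
- rewrite h2q /alpha0 ler_pdivrMr ?addr_gt0// mulrAC ler_pdivlMr//.
  by have := l0; nra.
- apply: (@le_trans _ _ 0); last by rewrite divr_ge0 ?sqr_ge0// ltW.
  by rewrite pmulr_rle0// pmulr_lle0 ?invr_gt0// ltW.
- have p0 : 0 < saddle_p r by rewrite divr_gt0//; have := l1; lra.
  have q0 : 0 < saddle_q r by rewrite divr_gt0// mulr_gt0//; lra.
  rewrite gtr0_norm//; apply: (@le_trans _ _ x); first by rewrite -pq; lra.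
  by rewrite ler_peMl ?(ltW x0)// invf_ge1//; have := l0; lra.
- apply: (@le_trans _ _ 1); first exact: ltW alpha0_lt1.
  by rewrite h2q ler_pdivlMr// mul1r; have := l0; nra.
- rewrite ler_pM2l// ler_pdivrMr// mulrC ler_pdivlMr ?exprn_gt0//.
  have : 0 <= (r - 1) * (r - lambda ^+ 2) by rewrite mulr_ge0//; have := l0; have := l1; nra.
  nra.
Qed.

End Saddle.

(** * The saddle point formula *)

Section SaddleAsymptotics.
Context {R : realType} (lambda : R).
Hypothesis lambda01 : 0 < lambda < 1.
Implicit Types x rho : R.
Notation mu := (@lebesgue_measure R).

Let l0 : 0 < lambda. Proof. by case/andP: lambda01. Qed.
Let l1 : lambda < 1. Proof. by case/andP: lambda01. Qed.

Lemma blaschke_circle rho t : saddle_dom lambda rho ->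
  blaschke lambda (rho%:C * expi t) = (rblaschke lambda rho)%:C *
   ((1 + (saddle_p lambda rho)%:C * (expi t - 1)) / (1 - (saddle_q lambda rho)%:C * (expi t - 1))).
Proof.
move=> dom; have [r0 rl rd lr] := saddle_dom_neq _ lambda01 _ dom.
have d0 := den_neq0 lambda rho lambda01 lr t.
have rd' : (1 - lambda * rho)%:C != 0 :> R[i] by rewrite fmorph_eq0 gt_eqF.
have rl' : (rho - lambda)%:C != 0 :> R[i] by rewrite fmorph_eq0.
rewrite /blaschke /rblaschke /saddle_p /saddle_q !fmorph_div/=.
have -> : 1 + rho%:C / (rho - lambda)%:C * (expi t - 1) =
    (rho%:C * expi t - lambda%:C) / (rho - lambda)%:C.
  apply: (mulIf rl'); rewrite divfK// mulrDl -!mulrA (mulrC (_^-1)) -!mulrA mulfV// mulr1.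
  by rewrite rmorphB/=; ring.
have -> : 1 - (lambda * rho)%:C / (1 - lambda * rho)%:C * (expi t - 1) =
    (1 - lambda%:C * (rho%:C * expi t)) / (1 - lambda * rho)%:C.
  apply: (mulIf rd'); rewrite divfK// mulrBl -!mulrA (mulrC (_^-1)) -!mulrA mulfV// mulr1.
  by rewrite rmorphB/= rmorphM/= rmorph1; ring.
move: (1 - lambda%:C * _) (rho%:C * _ - _) d0 rl' rd' => A B A0.
move: (rho - lambda)%:C (1 - lambda * rho)%:C => C D C0 D0.
by field; rewrite A0 C0 D0.
Qed.

Lemma blaschke_circleX rho t n k : saddle_dom lambda rho ->
  n%:R * (saddle_p lambda rho + saddle_q lambda rho) = k%:R ->
  blaschke lambda (rho%:C * expi t) ^+ n * (rho%:C * expi t) ^- k =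
  (rblaschke lambda rho ^+ n * rho ^- k)%:C *
  local_factor (saddle_p lambda rho) (saddle_q lambda rho) t ^+ n.
Proof.
move=> dom nx; rewrite blaschke_circle// /local_factor.
set p := saddle_p _ _ in nx *; set q := saddle_q _ _ in nx *.
move: (rblaschke _ _) ((1 + _) / _) => B M.
rewrite !exprMn [expi (_ * t) ^+ n]expiX.
have -> : n%:R * (- (p + q) * t) = - (k%:R * t) by rewrite -nx; ring.
rewrite -expiV -expiX invfM rmorphM fmorphV !rmorphXn.
exact: mulrACA.
Qed.

(** The contour is parametrised from [- z_+], so that the critical point is reached
    in the middle [t = pi] of the interval of integration. *)
Lemma blaschke_coef_integral x n k : saddle_range lambda x -> (0 < n)%N -> n%:R * x = k%:R ->
  let rho := zplus lambda x in
  let p := saddle_p lambda rho in let q := saddle_q lambda rho in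
  let tau := Num.sqrt (n%:R * local_var p q / 2) in
  2 * pi * blaschke_coef lambda n k = rblaschke lambda rho ^+ n * rho ^- k / tau *
   \int[mu]_(u in `[- (pi * tau), pi * tau]) complex.Re (local_factor p q (u / tau) ^+ n).
Proof.
move=> xr n0 nx rho p q tau.
have dom := zplus_dom _ lambda01 _ xr; rewrite -/rho in dom.
have [r0 rl rd lr] := saddle_dom_neq _ lambda01 _ dom.
have tau0 : 0 < tau.
  have [_ _ v0 _ _] := saddle_admissible _ lambda01 _ xr.
  by rewrite sqrtr_gt0 divr_gt0// mulr_gt0// ltr0n.
have nr0 : - rho != 0 by rewrite oppr_eq0.
have nlr : lambda * `|- rho| < 1 by rewrite normrN.
have := circle_int_blaschke lambda _ lambda01 nr0 nlr n k.
move=> /(congr1 (@complex.Re R)) /= <-.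
rewrite (@Rintegral_affine R _ tau)//; last first.
  exact: (ccontinuous_blaschke lambda _ lambda01 nr0 nlr n k).1.
have -> : rblaschke lambda rho ^+ n * rho ^- k / tau =
    tau^-1 * (rblaschke lambda rho ^+ n * rho ^- k).
  by rewrite mulrC.
rewrite -mulrA; congr (_ * _).
have [x0 qK v0 c2q K1p] := saddle_admissible _ lambda01 _ xr.
transitivity (\int[mu]_(u in `[- (pi * tau), pi * tau]) ((rblaschke lambda rho ^+ n * rho ^- k) *
    complex.Re (local_factor p q (u / tau) ^+ n))).
  apply: eq_Rintegral => u _.
  have -> : (- rho)%:C * expi (pi + u / tau) = rho%:C * expi (u / tau).
    by rewrite expiDpi rmorphN/= mulrNN.
  rewrite blaschke_circleX// ?zplus_pq//.
  by case: (local_factor _ _ _ ^+ n) => a b /=; rewrite mul0r subr0.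
rewrite RintegralZl//.
apply: continuous_integrable.
exact: (ccontinuousX _ n (ccontinuous_local_factor p q _ (alpha0_gt0 _ lambda01)
  (ltW (alpha0_lt1 _ lambda01)) c2q tau)).1.
Qed.

(** The hypothesis is the fourth power of the condition of [local_factor_gauss],
    in which no root is left.  It allows [x] to tend to 0, to infinity, and to the
    ends [alpha0] and [1 / alpha0] of [saddle_range]. *)
Theorem blaschke_coef_saddle (k : nat -> nat) :
  let x n : R := (k n)%:R / n%:R in
  (\forall n \near \oo, saddle_range lambda (x n)) ->
  (n%:R * (x n + x n ^+ 3)) ^+ 4 / ((k n)%:R ^+ 2 * saddle_disc lambda (x n)) ^+ 3
    @[n --> \oo] --> (0 : R) ->
  blaschke_coef lambda n (k n) /
    (1 / Num.sqrt (2 * (k n)%:R * pi) * (1 / saddle_disc lambda (x n) `^ (1 / 4))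
     * (rblaschke lambda (zplus lambda (x n)) ^+ n * zplus lambda (x n) ^- k n))
    @[n --> \oo] --> (1 : R).
Proof.
move=> x xr err.
pose p n := saddle_p lambda (zplus lambda (x n)).
pose q n := saddle_q lambda (zplus lambda (x n)).
have l1' : 0 < 1 - lambda by rewrite subr_gt0.
have K1 : 1 <= (1 - lambda)^-1 by rewrite invf_ge1//; have := l0; lra.
have K1' : 0 <= lambda / (1 - lambda) ^+ 2 by rewrite divr_ge0 ?sqr_ge0// ltW.
have a0 := alpha0_gt0 _ lambda01; have a1 := alpha0_lt1 _ lambda01.
have adm : \forall n \near \oo, admissible_pq (1 - lambda)^-1 (alpha0 lambda)
    (lambda / (1 - lambda) ^+ 2) (p n) (q n).
  by apply: filterS xr => n xrn; exact: saddle_admissible.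
have tau2 : \forall n \near \oo,
    gauss_scale p q n ^+ 2 = (k n)%:R * Num.sqrt (saddle_disc lambda (x n)) / 2
   /\ 0 < gauss_scale p q n.
  near=> n.
  have xrn : saddle_range lambda (x n) by near: n.
  have n0 : (0 < n)%N by near: n; exact: nbhs_infty_gt.
  have [_ _ v0 _ _] := saddle_admissible _ lambda01 _ xrn.
  split; last exact: gauss_scale_gt0.
  rewrite sqr_gauss_scale// zplus_local_var//; congr (_ / _); rewrite mulrA; congr (_ * _).
  by rewrite /x mulrCA divff ?mulr1// pnatr_eq0 -lt0n.
have errtau : n%:R * ((p n + q n) + (p n + q n) ^+ 3) / gauss_scale p q n ^+ 3
    @[n --> \oo] --> (0 : R).
  (* The fourth root of the hypothesis, since tau^4 = k^2 D / 4. *)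
  have h : Num.sqrt (Num.sqrt (64 * ((n%:R * (x n + x n ^+ 3)) ^+ 4
      / ((k n)%:R ^+ 2 * saddle_disc lambda (x n)) ^+ 3)))
      @[n --> \oo] --> Num.sqrt (Num.sqrt (64 * 0 : R)).
    by apply: continuous_cvg; [exact: sqrt_continuous|apply: continuous_cvg;
      [exact: sqrt_continuous|apply: cvgM => //; exact: cvg_cst]].
  rewrite mulr0 !sqrtr0 in h.
  apply: cvg_trans h; apply: near_eq_cvg; near=> n.
  have xrn : saddle_range lambda (x n) by near: n.
  have [t2 t0] : gauss_scale p q n ^+ 2 = (k n)%:R * Num.sqrt (saddle_disc lambda (x n)) / 2
   /\ 0 < gauss_scale p q n by near: n.
  have x0 := saddle_range_gt0 _ lambda01 _ xrn.
  have D0 := saddle_disc_gt0 _ lambda01 _ xrn.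
  rewrite zplus_pq//.
  have t4 : (k n)%:R ^+ 2 * saddle_disc lambda (x n) = 4 * gauss_scale p q n ^+ 4.
    have -> : gauss_scale p q n ^+ 4 = (gauss_scale p q n ^+ 2) ^+ 2 by rewrite -exprM.
    by rewrite -[in LHS](sqr_sqrtr (ltW D0)) t2; field.
  rewrite t4.
  have -> : 64 * ((n%:R * (x n + x n ^+ 3)) ^+ 4 / (4 * gauss_scale p q n ^+ 4) ^+ 3) =
     ((n%:R * (x n + x n ^+ 3) / gauss_scale p q n ^+ 3) ^+ 2) ^+ 2.
    by field; rewrite gt_eqF.
  have y0 : 0 <= n%:R * (x n + x n ^+ 3) / gauss_scale p q n ^+ 3.
    rewrite divr_ge0 ?exprn_ge0 ?(ltW t0)// mulr_ge0//.
    by rewrite addr_ge0 ?exprn_ge0// ltW.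
  by rewrite sqrtr_sqr ger0_norm ?sqr_ge0// sqrtr_sqr ger0_norm.
have gauss := local_factor_gauss _ _ _ p q K1 a0 (ltW a1) K1' adm errtau.
have sp0 : 0 < Num.sqrt pi :> R by rewrite sqrtr_gt0 pi_gt0.
have h : (\int[mu]_(u in `[- (pi * gauss_scale p q n), pi * gauss_scale p q n])
     complex.Re (local_factor (p n) (q n) (u / gauss_scale p q n) ^+ n)) / Num.sqrt pi
     @[n --> \oo] --> (1 : R).
  rewrite -[X in _ --> X](@divff _ (Num.sqrt pi : R)) ?gt_eqF//.
  by apply: cvgM => //; exact: cvg_cst.
apply: cvg_trans h; apply: near_eq_cvg.
near=> n.
have xrn : saddle_range lambda (x n) by near: n.
have n0 : (0 < n)%N by near: n; exact: nbhs_infty_gt.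
have [t2 t0] : gauss_scale p q n ^+ 2 = (k n)%:R * Num.sqrt (saddle_disc lambda (x n)) / 2
   /\ 0 < gauss_scale p q n by near: n.
have x0 := saddle_range_gt0 _ lambda01 _ xrn.
have D0 := saddle_disc_gt0 _ lambda01 _ xrn.
have nx : n%:R * x n = (k n)%:R by rewrite /x mulrCA divff ?mulr1// pnatr_eq0 -lt0n.
have := blaschke_coef_integral _ _ _ xrn n0 nx.
rewrite -/(p n) -/(q n) -/(gauss_scale p q n) /=.
set J := (\int[mu]_(u in _) _); set b := blaschke_coef _ _ _.
set t := gauss_scale p q n in t2 t0 *.
have k0 : 0 < (k n)%:R :> R by rewrite -nx mulr_gt0// ltr0n.
have -> : Num.sqrt (2 * (k n)%:R * pi) =
    2 * t * Num.sqrt pi * (1 / saddle_disc lambda (x n) `^ (1 / 4)).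
  have -> : (1 / saddle_disc lambda (x n) `^ (1 / 4)) =
      (Num.sqrt (Num.sqrt (saddle_disc lambda (x n))))^-1.
    by rewrite div1r powR14// ltW.
  have : 0 < Num.sqrt (Num.sqrt (saddle_disc lambda (x n))) by rewrite !sqrtr_gt0.
  have := sqr_sqrtr (sqrtr_ge0 (saddle_disc lambda (x n))).
  move: (Num.sqrt (Num.sqrt _)) => W WS W0.
  have -> : 2 * (k n)%:R * pi = (2 * t * Num.sqrt pi / W) ^+ 2.
    rewrite !exprMn t2 -WS sqr_sqrtr ?pi_ge0//; field.
    by rewrite gt_eqF.
  by rewrite sqrtr_sqr ger0_norm// !mulr_ge0// ?invr_ge0 ltW.
have Dp : 0 < 1 / saddle_disc lambda (x n) `^ (1 / 4) by rewrite divr_gt0// powR_gt0.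
have [r0 rl rd lr] := saddle_dom_neq _ lambda01 _ (zplus_dom _ lambda01 _ xrn).
have B0 : rblaschke lambda (zplus lambda (x n)) ^+ n * zplus lambda (x n) ^- k n != 0.
  apply: mulf_neq0; last by rewrite invr_neq0// expf_neq0.
  by apply: expf_neq0; apply: mulf_neq0 => //; rewrite invr_neq0// gt_eqF.
move: (rblaschke _ _ ^+ n * _) B0 => B B0 hb.
have -> : b = B / t * J / (2 * pi) by rewrite -hb mulrC mulKf// gt_eqF// twopi_gt0.
have pE : pi = Num.sqrt pi ^+ 2 :> R by rewrite sqr_sqrtr// pi_ge0.
rewrite pE; move: (Num.sqrt pi) (1 / _ `^ _) sp0 Dp => P D P0 Dp.
by rewrite sqrtr_sqr gtr0_norm//; field; rewrite B0 !gt_eqF.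
Unshelve. all: by end_near. Qed.

End SaddleAsymptotics.

(** * The critical value as a function of the critical point *)

Section CriticalValue.
Context {R : realType} (m : R).
Hypotheses (m_bound : -1 < m < 1) (m0 : m != 0).
Implicit Types r : R.

(** The parameter [m] is [- lambda] on the left, where [0 < r = - z_+ < 1],
    and [lambda] on the right, where [r = z_+ > 1]; in both cases
    [|b (z_+)| = (r - m) / (1 - m r)]. *)
Definition qform r : R := (r - m) * (1 - m * r).
Definition saddle_ratio r : R := (1 - m ^+ 2) * r / qform r.
(** The value of [log |b| - x log |z|] at its critical point [r], [x] being
    [saddle_ratio r]. *)
Definition crit_value r : R := ln ((r - m) / (1 - m * r)) - saddle_ratio r * ln r.
Definition crit_dom r := [/\ 0 < r, 0 < r - m & 0 < 1 - m * r].

Lemma crit_dom1 : crit_dom 1.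
Proof. by have /andP[a b] := m_bound; split => //; rewrite ?subr_gt0 ?mulr1. Qed.

Lemma crit_value1 : crit_value 1 = 0.
Proof.
have [_ a b] := crit_dom1.
by rewrite /crit_value ln1 mulr0 subr0 mulr1 divff ?ln1// gt_eqF.
Qed.

Lemma qform_gt0 r : crit_dom r -> 0 < qform r.
Proof. by case=> *; rewrite mulr_gt0. Qed.

(** Only the derivative of [saddle_ratio] contributes, because [r] is critical. *)
Lemma is_derive_crit_value r : crit_dom r ->
  is_derive r 1 crit_value (- (1 - m ^+ 2) * m * (r ^+ 2 - 1) / qform r ^+ 2 * ln r).
Proof.
move=> [r0 r1 r2].
have r1' : r - m != 0 by rewrite gt_eqF.
have r2' : 1 - m * r != 0 by rewrite gt_eqF.
have r0' : r != 0 by rewrite gt_eqF.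
have q' : (r - m) / (1 - m * r) > 0 by rewrite divr_gt0.
have q0 : qform r != 0 by rewrite mulf_neq0.
have dV : is_derive r 1 (fun r : R => (1 - m * r)^-1) (m / (1 - m * r) ^+ 2).
  have d : is_derive r 1 (fun r : R => 1 - m * r) (- m).
    by apply: is_derive_eq; rewrite /GRing.scale/=; ring.
  rewrite (_ : m / _ = - (1 - m * r) ^- 2 *: (- m)); last by rewrite /GRing.scale/=; ring.
  exact: is_deriveV.
have dV' : is_derive r 1 (fun r : R => (qform r)^-1)
    (- ((1 - m * r) - m * (r - m)) / qform r ^+ 2).
  have d : is_derive r 1 qform ((1 - m * r) - m * (r - m)).
    by rewrite /qform; apply: is_derive_eq; rewrite /GRing.scale/=; ring.
  rewrite (_ : - _ / _ = - (qform r) ^- 2 *: ((1 - m * r) - m * (r - m))).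
    exact: is_deriveV.
  by rewrite /GRing.scale/=; ring.
have d1 : is_derive r 1 (fun r : R => (r - m) / (1 - m * r)) ((1 - m ^+ 2) / (1 - m * r) ^+ 2).
  by apply: is_derive_eq; rewrite /GRing.scale/=; field; exact: r2'.
have d2 : is_derive r 1 saddle_ratio ((1 - m ^+ 2) * m * (r ^+ 2 - 1) / qform r ^+ 2).
  rewrite /saddle_ratio; apply: is_derive_eq; rewrite /GRing.scale/= /qform.
  by field; rewrite ?r1' ?r2'.
have d3 := is_derive1_ln q'.
have d4 := is_derive1_ln r0.
have d5 : is_derive r 1 (fun r : R => ln ((r - m) / (1 - m * r)))
   ((1 - m ^+ 2) / (1 - m * r) ^+ 2 * ((r - m) / (1 - m * r))^-1).
  by rewrite mulrC; exact: (@is_derive1_comp R _ (fun r : R => (r - m) / (1 - m * r)) r _ _ d3 d1).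
rewrite /crit_value; apply: is_derive_eq; rewrite /GRing.scale/= /saddle_ratio /qform; field.
by rewrite ?r0' ?r1' ?r2'.
Qed.

(** The critical value vanishes at 1 and its derivative has the sign of
    [- m (r - 1) ln r]. *)
Lemma crit_value_le0 r : crit_dom r -> 0 <= m * (r - 1) -> crit_value r <= 0.
Proof.
move=> dr mr; have /andP[mN1 m1] := m_bound.
have d1 := crit_dom1.
have m2 : 0 < 1 - m ^+ 2 by nra.
have dom a b c : crit_dom a -> crit_dom b -> c \in `[a, b] -> crit_dom c.
  move=> [a0 a1 a2] [b0 b1 b2]; rewrite in_itv/= => /andP[ac cb].
  have h : 0 <= (c - a) * (b - c) by rewrite mulr_ge0// subr_ge0.
  split; [lra|lra|].
  by have [m0'|m0'] := leP 0 m; nra.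
have cont a b : crit_dom a -> crit_dom b -> {within `[a, b], continuous crit_value}.
  move=> da db; apply: derivable_within_continuous => c cab.
  by apply: ex_derive; apply: is_derive_crit_value; exact: dom cab.
have mvt a b : crit_dom a -> crit_dom b -> a <= b -> exists2 c, c \in `[a, b] &
    crit_value b - crit_value a =
      - (1 - m ^+ 2) * m * (c ^+ 2 - 1) / qform c ^+ 2 * ln c * (b - a).
  move=> da db ab; apply: (@MVT_segment R crit_value
    (fun c => - (1 - m ^+ 2) * m * (c ^+ 2 - 1) / qform c ^+ 2 * ln c)
    _ _ ab _ (cont _ _ da db)).
  move=> c cab; apply: is_derive_crit_value; apply: (dom _ _ _ da db).
  exact: subset_itv_oo_cc cab.
have key c : 0 < c -> 0 <= m * (c - 1) ->
    (1 - m ^+ 2) * m * (c ^+ 2 - 1) / qform c ^+ 2 >= 0.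
  move=> c0 mc; rewrite divr_ge0 ?sqr_ge0// -mulrA mulr_ge0 ?(ltW m2)//.
  rewrite (_ : m * _ = (m * (c - 1)) * (c + 1)); last by ring.
  by rewrite mulr_ge0// addr_ge0// ltW.
have [r1|r1] := leP r 1.
  have [c crb] := mvt _ _ dr d1 r1; rewrite crit_value1 sub0r => e.
  have [c0 _ _] := dom _ _ _ dr d1 crb.
  move: crb; rewrite in_itv/= => /andP[rc c1].
  have mc : 0 <= m * (c - 1).
    have [e1|r1'] := eqVneq r 1; first by rewrite (_ : c = 1) ?subrr ?mulr0//; lra.
    have r1'' : r < 1 by rewrite lt_neqAle r1'.
    nra.
  have := key c c0 mc; have lc := ln_le0 c1; rewrite -oppr_ge0 e !mulNr.
  move: (_ / _) => y y0; rewrite oppr_ge0 mulr_le0_ge0 ?subr_ge0// mulr_ge0_le0//.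
have [c crb] := mvt _ _ d1 dr (ltW r1); rewrite crit_value1 subr0 => ->.
have [c0 _ _] := dom _ _ _ d1 dr crb.
move: crb; rewrite in_itv/= => /andP[c1 cr].
have mc : 0 <= m * (c - 1) by nra.
have := key c c0 mc; have lc := ln_ge0 c1; rewrite !mulNr.
by move: (_ / _) => y y0; rewrite oppr_le0 !mulr_ge0// subr_ge0 ltW.
Qed.

(* The value at 1 is chosen so that the quotient is continuous there. *)
Let lnq r := if r == 1 then 1 else ln r / (r - 1).

Lemma ln_quotient_cvg1 : lnq r @[r --> (1 : R)] --> (1 : R).
Proof.
apply/cvgrPdist_le => e e0.
near=> r.
have r12 : 2^-1 < r.
  near: r; apply: lt_nbhsr; lra.
have re : `|1 - r| < e / 2.
  near: r; apply: (@cvgr_dist_lt _ _ _ _ _ id); [exact: cvg_id|by rewrite divr_gt0].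
rewrite /lnq; case: eqVneq => [_|r1]; first by rewrite subrr normr0 ltW.
have r0 : 0 < r by lra.
have r1' : r - 1 != 0 by rewrite subr_eq0.
have h1 : ln r <= r - 1.
  have := @le_ln1Dx R (r - 1); rewrite (_ : 1 + (r - 1) = r); [by apply; lra|by ring].
have h2 : 1 - r^-1 <= ln r.
  have := @le_ln1Dx R (r^-1 - 1).
  rewrite (_ : 1 + (r^-1 - 1) = r^-1); last by ring.
  rewrite lnV ?posrE// => h.
  have : 0 < r^-1 by rewrite invr_gt0.
  by move=> rV; have := h ltac:(lra); lra.
have -> : 1 - ln r / (r - 1) = (r - 1 - ln r) / (r - 1) by field.
rewrite normrM normfV ler_pdivrMr ?normr_gt0// ger0_norm ?subr_ge0//.
apply: (@le_trans _ _ (`|1 - r| ^+ 2 / r)).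
  rewrite real_normK ?num_real// ler_pdivlMr//.
  have : (1 - r^-1) * r <= ln r * r by rewrite ler_pM2r.
  by rewrite mulrBl mulVf ?gt_eqF//; lra.
rewrite ler_pdivrMr// expr2 (distrC r) mulrAC ler_wpM2r//.
nra.
Unshelve. all: by end_near. Qed.

(** L'Hopital's rule: the derivative of [crit_value] is
    [- (1 - m ^ 2) m (r + 1) / qform r ^ 2 * (r - 1) * ln r], and
    [(r - 1) * ln r] is equivalent to [(r - 1) ^ 2]. *)
Lemma cvg_crit_value (u : nat -> R) : u n @[n --> \oo] --> (1 : R) ->
  (\forall n \near \oo, u n != 1) ->
  crit_value (u n) / (u n - 1) ^+ 3 @[n --> \oo] -->
  - (2 * m * (1 + m) / (3 * (1 - m) ^+ 3)).
Proof.
move=> u1 un1.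
have /andP[mN1 m1] := m_bound.
(* Small enough for [r - m] and [1 - m r] to be positive on ]1 - e, 1 + e[. *)
pose e := (1 - `|m|) / 2.
have am : `|m| < 1 by rewrite ltr_norml; exact/andP.
have e0 : 0 < e by rewrite divr_gt0// subr_gt0.
have dom r : r \in `](1 - e), (1 + e)[ -> crit_dom r.
  rewrite in_itv/= => /andP[]; rewrite /e => ra rb.
  have := normr_ge0 m; have := ler_norm m; have := ler_norm (- m); rewrite normrN => h1 h2 h3.
  split; [lra|lra|].
  have : m * r <= `|m| * r by rewrite ler_wpM2r//; lra.
  nra.
pose L := - (2 * m * (1 + m) / (3 * (1 - m) ^+ 3)).
(* The values of [df] and [dg] at 1 only serve to make [df / dg] continuous. *)
pose df r := if r == 1 then L else - (1 - m ^+ 2) * m * (r ^+ 2 - 1) / qform r ^+ 2 * ln r.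
pose dg r := if r == 1 then 1 else 3 * (r - 1) ^+ 2.
have [q0 q1] : 0 < qform 1 /\ qform 1 = (1 - m) ^+ 2.
  by split; [exact: qform_gt0 crit_dom1|rewrite /qform; ring].
have lh : crit_value r / (r - 1) ^+ 3 @[r --> (1 : R)^'] --> L.
  apply: (@lhopital R crit_value df (fun r => (r - 1) ^+ 3) dg (1 - e) (1 + e) 1 L).
  - by rewrite in_itv/=; apply/andP; split; lra.
  - move=> r; rewrite inE/= => -[rab /eqP r1].
    by rewrite /df (negbTE r1); apply: is_derive_crit_value; apply: dom.
  - move=> r; rewrite inE/= => -[rab /eqP r1].
    rewrite /dg (negbTE r1); apply: is_derive_eq; rewrite /GRing.scale/=; ring.
  - have := is_derive_crit_value 1 crit_dom1.
    move=> h; rewrite -crit_value1; apply: differentiable_continuous.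
    by apply/derivable1_diffP; exact: ex_derive.
  - rewrite [X in _ --> X](_ : 0 = (1 - 1) ^+ 3 :> R); last by rewrite subrr expr0n.
    by apply: cvg_expn; apply: cvgB; [exact: cvg_id|exact: cvg_cst].
  - move=> r; rewrite inE/= => -[rab /eqP r1].
    by rewrite /dg (negbTE r1) mulf_neq0// expf_neq0// subr_eq0.
  have -> : (fun r => df r / dg r) =
      (fun r => - (1 - m ^+ 2) * m * (r + 1) / (3 * qform r ^+ 2) * lnq r).
    apply/funext => r; rewrite /df /dg /lnq; case: eqVneq => [->|r1].
      rewrite q1 /L divr1 mulr1; field.
      by rewrite subr_eq0 gt_eqF.
    have r1' : r - 1 != 0 by rewrite subr_eq0.
    rewrite (invfM 3 (qform r ^+ 2)); move: (qform r ^+ 2)^-1 (ln r) => y l.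
    by field.
  have -> : L = - (1 - m ^+ 2) * m * (1 + 1) / (3 * qform 1 ^+ 2) * 1.
    by rewrite /L q1; field; rewrite subr_eq0 gt_eqF.
  apply: cvgM; last exact: ln_quotient_cvg1.
  have cq : qform r @[r --> (1 : R)] --> qform 1.
    apply: cvgM; first by apply: cvgB; [exact: cvg_id|exact: cvg_cst].
    by apply: cvgB; [exact: cvg_cst|apply: cvgM; [exact: cvg_cst|exact: cvg_id]].
  apply: cvgM.
    apply: cvgM; first exact: cvg_cst.
    by apply: cvgD; [exact: cvg_id|exact: cvg_cst].
  apply: cvgV; first by rewrite mulf_neq0// expf_neq0// gt_eqF.
  by apply: cvgM; [exact: cvg_cst|exact: cvg_expn].
have u1' : u n @[n --> \oo] --> (1 : R)^'.
  move=> A /= hA; have hA' : \forall y \near (1 : R), y != 1 -> A y by exact: hA.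
  by apply: filterS2 (u1 _ hA') un1 => n; apply.
exact: cvg_comp u1' lh.
Qed.

End CriticalValue.

Section GammaCrit.
Context {R : realType} (m : R).
Hypotheses (m_bound : -1 < m < 1) (m0 : m != 0).

(** [(1 + m) / (1 - m)] is the value at 1, namely [alpha0] on the left and
    [1 / alpha0] on the right; the difference is of second order. *)
Lemma saddle_ratio_sub (r : R) : crit_dom m r ->
  saddle_ratio m r - (1 + m) / (1 - m) = (1 + m) * m * (r - 1) ^+ 2 / ((1 - m) * qform m r).
Proof.
move=> dr; have q0 := qform_gt0 _ _ dr; have /andP[mN1 m1] := m_bound.
have r1 : r - m != 0 by case: dr => _ h _; rewrite gt_eqF.
have r2 : 1 - m * r != 0 by case: dr => _ _ h; rewrite gt_eqF.
have m1' : 1 - m != 0 by rewrite subr_eq0 gt_eqF.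
by rewrite /saddle_ratio /qform; field; rewrite ?r1 ?r2 ?m1'.
Qed.

(** By [saddle_ratio_sub], the half-integral powers of the distance from [x] to
    [alpha0] or [1 / alpha0] are rational in [r], up to the square root of
    [qform r], which has a limit. *)
Lemma cubic_scale (r : R) : crit_dom m r -> 0 < m * (r - 1) ->
  (`|saddle_ratio m r - (1 + m) / (1 - m)| `^ (3 / 2) * (1 - m) `^ (3 / 2))
    / (`|m| * (1 + m)) `^ (1 / 2) =
  m * (1 + m) * (r - 1) ^+ 3 / (qform m r * Num.sqrt (qform m r)).
Proof.
move=> dr mr; have q0 := qform_gt0 _ _ dr; have /andP[mN1 m1] := m_bound.
have p1 : 0 < 1 + m by lra.
have p2 : 0 < 1 - m by lra.
have am : 0 < `|m| by rewrite normr_gt0.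
rewrite !powR32 ?(ltW p2)//.
rewrite (_ : 1 / 2 = 2^-1); last by rewrite div1r.
rewrite powR12_sqrt ?mulr_ge0 ?(ltW p1)// -exprMn -sqrtrM//.
have -> : `|saddle_ratio m r - (1 + m) / (1 - m)| * (1 - m) =
   (`|m| * (1 + m)) * `|r - 1| ^+ 2 / qform m r.
  rewrite saddle_ratio_sub// !normrM normfV normrM (gtr0_norm p1) (gtr0_norm p2) (gtr0_norm q0).
  by field; rewrite !gt_eqF.
rewrite sqrtrM ?mulr_ge0 ?sqr_ge0 ?(ltW p1)// sqrtrV ?(ltW q0)// sqrtrM ?mulr_ge0 ?(ltW p1)//.
rewrite sqrtr_sqr normr_id.
have sA : 0 < Num.sqrt (`|m| * (1 + m)) by rewrite sqrtr_gt0 mulr_gt0.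
have eA := sqr_sqrtr (ltW (mulr_gt0 am p1)).
have sQ : 0 < Num.sqrt (qform m r) by rewrite sqrtr_gt0.
have eQ := sqr_sqrtr (ltW q0).
have hm : m * (r - 1) ^+ 3 = `|m| * `|r - 1| ^+ 3.
  have -> : m * (r - 1) ^+ 3 = (m * (r - 1)) * (r - 1) ^+ 2 by ring.
  have -> : `|m| * `|r - 1| ^+ 3 = `|m * (r - 1)| * `|r - 1| ^+ 2 by rewrite normrM; ring.
  by rewrite gtr0_norm// real_normK// num_real.
have -> : m * (1 + m) * (r - 1) ^+ 3 = (`|m| * (1 + m)) * `|r - 1| ^+ 3.
  by rewrite mulrAC hm; ring.
move: (Num.sqrt (`|m| * _)) (Num.sqrt (qform _ _)) sA eA sQ eQ => A Q A0 eA Q0 eQ.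
by rewrite -eA -eQ; field; rewrite !gt_eqF.
Qed.

Lemma cvg_cubic_scale (u : nat -> R) : u n @[n --> \oo] --> (1 : R) ->
  (\forall n \near \oo, crit_dom m (u n) /\ 0 < m * (u n - 1)) ->
  3 / 2 * crit_value m (u n) / (- ((`|saddle_ratio m (u n) - (1 + m) / (1 - m)| `^ (3 / 2)
      * (1 - m) `^ (3 / 2)) / (`|m| * (1 + m)) `^ (1 / 2))) @[n --> \oo] --> (1 : R).
Proof.
move=> u1 ud; have /andP[mN1 m1] := m_bound.
have p1 : 0 < 1 + m by lra.
have p2 : 0 < 1 - m by lra.
have un1 : \forall n \near \oo, u n != 1.
  apply: filterS ud => n [_ mu]; apply/eqP => e; move: mu.
  by rewrite e subrr mulr0 ltxx.
have cq : qform m (u n) @[n --> \oo] --> qform m 1.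
  apply: cvgM; first by apply: cvgB => //; exact: cvg_cst.
  by apply: cvgB; [exact: cvg_cst|apply: cvgM => //; exact: cvg_cst].
have q1 : qform m 1 = (1 - m) ^+ 2 by rewrite /qform; ring.
have h : - (3 / 2) / (m * (1 + m)) * (crit_value m (u n) / (u n - 1) ^+ 3)
   * (qform m (u n) * Num.sqrt (qform m (u n))) @[n --> \oo] --> (1 : R).
  rewrite [X in _ --> X](_ : 1 = - (3 / 2) / (m * (1 + m))
    * (- (2 * m * (1 + m) / (3 * (1 - m) ^+ 3))) * (qform m 1 * Num.sqrt (qform m 1))).
    apply: cvgM; first by apply: cvgM; [exact: cvg_cst|exact: cvg_crit_value].
    by apply: cvgM => //; apply: continuous_cvg => //; exact: sqrt_continuous.
  rewrite q1 sqrtr_sqr gtr0_norm//; field.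
  by rewrite m0 !gt_eqF.
apply: cvg_trans h; apply: near_eq_cvg; near=> n.
have [dn mu] : crit_dom m (u n) /\ 0 < m * (u n - 1) by near: n.
rewrite cubic_scale//.
have q0 := qform_gt0 _ _ dn.
have sQ : 0 < Num.sqrt (qform m (u n)) by rewrite sqrtr_gt0.
have un : u n - 1 != 0 by rewrite subr_eq0; near: n.
move: (Num.sqrt _) sQ => S S0.
by field; rewrite un m0 !gt_eqF.
Unshelve. all: by end_near. Qed.

End GammaCrit.

(** * The numbers gamma ^ 3 *)

Section GammaSaddle.
Context {R : realType} (lambda : R).
Hypothesis lambda01 : 0 < lambda < 1.
Implicit Types x : R.

Let l0 : 0 < lambda. Proof. by case/andP: lambda01. Qed.
Let l1 : lambda < 1. Proof. by case/andP: lambda01. Qed.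

Lemma modulus_real x : modulus (x%:C : R[i]) = `|x|.
Proof. by rewrite /modulus/= expr0n/= addr0 sqrtr_sqr. Qed.

Lemma log_principal_gt0 x : 0 < x -> log_principal (x%:C : R[i]) = (ln x)%:C.
Proof.
move=> x0; rewrite /log_principal /arg_principal modulus_real/= lexx gtr0_norm//.
by rewrite divff ?gt_eqF// acos1.
Qed.

Lemma log_cutpos_lt0 x : x < 0 -> log_cutpos (x%:C : R[i]) = (ln (- x))%:C + 'i * pi%:C.
Proof.
move=> x0; rewrite /log_cutpos /arg_cutpos modulus_real/= lexx ltr0_norm//.
rewrite invrN mulrN divff ?lt_eqF// acosN1.
by apply/eqP; rewrite eq_complex/= !(mul0r, mulr0, mul1r, subr0, addr0, add0r) !eqxx.
Qed.

Lemma expR_logs (b r x : R) n k : 0 < b -> 0 < r -> n%:R * x = k%:R ->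
  expR (n%:R * (ln b - x * ln r)) = b ^+ n * r ^- k.
Proof.
move=> b0 r0 nx; rewrite mulrBr mulrA nx expRD expRM_natl lnK ?posrE//.
by rewrite expRN expRM_natl lnK ?posrE.
Qed.

Section Left.
Variable x : R.
Hypothesis x_range : 0 < x < alpha0 lambda.
Let z := zplus lambda x.
Let xr : saddle_range lambda x. Proof. by left. Qed.

Lemma left_m_bound : -1 < - lambda < 1.
Proof. by have := l0; have := l1; move=> *; apply/andP; split; lra. Qed.

Lemma left_crit_dom : crit_dom (- lambda) (- z).
Proof.
have /andP[a b] : -1 < z < 0 := zplus_left _ lambda01 _ x_range.
have := l0; have := l1; move=> l1' l0'.
by split; nra.
Qed.

Lemma left_side : 0 < - lambda * (- z - 1).
Proof. by have /andP[a b] : -1 < z < 0 := zplus_left _ lambda01 _ x_range; have := l0; nra. Qed.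

Lemma left_saddle_ratio : saddle_ratio (- lambda) (- z) = x.
Proof.
have q0 := qform_gt0 _ _ left_crit_dom.
have quad := zplus_quadratic _ lambda01 _ xr.
rewrite /saddle_ratio; apply: (mulIf (lt0r_neq0 q0)); rewrite divfK ?gt_eqF//.
by move: quad; rewrite -/z /qform sqrrN => quad; lra.
Qed.

Lemma left_rblaschke : rblaschke lambda z = - ((- z - - lambda) / (1 - - lambda * - z)).
Proof. by rewrite /rblaschke mulrNN -[RHS]mulNr opprB opprK [- lambda + z]addrC. Qed.

(** With the determination [log (- 1) = i pi], the two logarithms of negative
    numbers contribute [i pi (1 - x)], which the definition subtracts. *)
Lemma left_gamma : gamma3_alpha0 lambda x = (3 / 2 * crit_value (- lambda) (- z))%:C.
Proof.
have [a b c] := left_crit_dom; have /andP[z1 z0] : -1 < z < 0 := zplus_left _ lambda01 _ x_range.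
have q0 : 0 < (- z - - lambda) / (1 - - lambda * - z) by rewrite divr_gt0.
rewrite /gamma3_alpha0 /Phi -/z blaschke_real log_cutpos_lt0; last first.
  by rewrite left_rblaschke oppr_lt0.
rewrite log_cutpos_lt0// /crit_value left_saddle_ratio left_rblaschke opprK.
rewrite !(rmorphM, rmorphB, fmorphV, rmorph_nat)/=.
move: (ln _)%:C (ln _)%:C pi%:C => A B C.
by rewrite ?complexiE; field.
Qed.

Lemma left_modulus : modulus (gamma3_alpha0 lambda x) = - (3 / 2 * crit_value (- lambda) (- z)).
Proof.
rewrite left_gamma modulus_real ler0_norm// pmulr_rle0//.
by apply: (crit_value_le0 _ left_m_bound _ left_crit_dom); rewrite ltW// left_side.
Qed.

(** Each of the [n] factors [b (z_+)] and the [k] factors [1 / z_+] is negative,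
    whence the sign. *)
Lemma left_value n k : n%:R * x = k%:R ->
  rblaschke lambda z ^+ n * z ^- k =
  (-1) ^ (n%:Z - k%:Z) * expR (- (2 / 3) * n%:R * modulus (gamma3_alpha0 lambda x)).
Proof.
move=> nx; have [a b c] := left_crit_dom.
rewrite left_modulus (_ : - (2 / 3) * _ * _ = n%:R * crit_value (- lambda) (- z)); last by field.
rewrite /crit_value left_saddle_ratio (@expR_logs _ _ _ _ k)// ?divr_gt0//.
rewrite left_rblaschke.
set B := (- z - - lambda) / _; have -> : z ^- k = (- - z) ^- k by rewrite opprK.
rewrite expfzDr ?oppr_eq0 ?oner_eq0// -exprnN.
rewrite (exprNn B) (exprNn (- z)) invfM.
rewrite /= -!exprnP.
by rewrite mulrACA.
Qed.

End Left.

Section Right.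
Variable x : R.
Hypothesis x_range : (alpha0 lambda)^-1 < x.
Let z := zplus lambda x.
Let xr : saddle_range lambda x. Proof. by right. Qed.

Lemma right_m_bound : -1 < lambda < 1.
Proof. by have := l0; have := l1; move=> *; apply/andP; split; lra. Qed.

Lemma right_crit_dom : crit_dom lambda z.
Proof.
have [a b] : 1 < z /\ lambda * z < 1 := zplus_right _ lambda01 _ x_range.
by have := l1; move=> l1'; split; lra.
Qed.

Lemma right_side : 0 < lambda * (z - 1).
Proof.
have [a b] : 1 < z /\ lambda * z < 1 := zplus_right _ lambda01 _ x_range.
by rewrite mulr_gt0// subr_gt0.
Qed.

Lemma right_saddle_ratio : saddle_ratio lambda z = x.
Proof.
have q0 := qform_gt0 _ _ right_crit_dom.
have quad := zplus_quadratic _ lambda01 _ xr.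
rewrite /saddle_ratio; apply: (mulIf (lt0r_neq0 q0)); rewrite divfK ?gt_eqF//.
by move: quad; rewrite -/z /qform => quad; lra.
Qed.

Lemma right_gamma : gamma3_alpha0V lambda x = (3 / 2 * crit_value lambda z)%:C.
Proof.
have [a b c] := right_crit_dom.
have q0 : 0 < rblaschke lambda z by rewrite divr_gt0.
rewrite /gamma3_alpha0V /Phi -/z blaschke_real !log_principal_gt0//.
rewrite /crit_value right_saddle_ratio.
by rewrite !(rmorphM, rmorphB, fmorphV, rmorph_nat)/=.
Qed.

Lemma right_modulus : modulus (gamma3_alpha0V lambda x) = - (3 / 2 * crit_value lambda z).
Proof.
rewrite right_gamma modulus_real ler0_norm// pmulr_rle0//.
by apply: (crit_value_le0 _ right_m_bound _ right_crit_dom); rewrite ltW// right_side.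
Qed.

Lemma right_value n k : n%:R * x = k%:R ->
  rblaschke lambda z ^+ n * z ^- k =
  expR (- (2 / 3) * n%:R * modulus (gamma3_alpha0V lambda x)).
Proof.
move=> nx; have [a b c] := right_crit_dom.
rewrite right_modulus (_ : - (2 / 3) * _ * _ = n%:R * crit_value lambda z); last by field.
by rewrite /crit_value right_saddle_ratio (@expR_logs _ _ _ _ k)// ?divr_gt0.
Qed.

End Right.

(** Used at the points [a] where [z_+] reaches the unit circle: there the radicand
    [c ^ 2 - 1] vanishes. *)
Lemma cvg_zplus (u : nat -> R) (a c : R) : u n @[n --> \oo] --> a -> a != 0 ->
  c = (a * (1 + lambda ^+ 2) - (1 - lambda ^+ 2)) / (2 * lambda * a) -> c ^+ 2 = 1 ->
  zplus lambda (u n) @[n --> \oo] --> c.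
Proof.
move=> ua a0 ca c1.
have cc : (u n * (1 + lambda ^+ 2) - (1 - lambda ^+ 2)) / (2 * lambda * u n) @[n --> \oo] --> c.
  rewrite ca; apply: cvgM.
    by apply: cvgB; [apply: cvgM => //; exact: cvg_cst|exact: cvg_cst].
  apply: cvgV; first by rewrite !mulf_neq0// gt_eqF.
  by apply: cvgM => //; exact: cvg_cst.
rewrite -[X in _ --> X]addr0; apply: cvgD => //.
rewrite [X in _ --> X](_ : 0 = Num.sqrt (c ^+ 2 - 1)); last by rewrite c1 subrr sqrtr0.
apply: continuous_cvg; first exact: sqrt_continuous.
by apply: cvgB; [exact: cvg_expn|exact: cvg_cst].
Qed.

Lemma gamma3_alpha0_equiv (k : nat -> nat) :
  (k n)%:R / n%:R @[n --> \oo] --> alpha0 lambda ->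
  (\forall n \near \oo, (k n)%:R / n%:R < alpha0 lambda) ->
  (fun n : nat => gamma3_alpha0 lambda ((k n)%:R / n%:R)) ~~[ \oo ]
  (fun n : nat =>
     let x : R := (k n)%:R / n%:R in
     (- (((alpha0 lambda - x) `^ (3 / 2) * (1 + lambda) `^ (3 / 2))
           / (lambda * (1 - lambda)) `^ (1 / 2)))%:C).
Proof.
move=> xa xlt; have a0 := alpha0_gt0 _ lambda01.
pose x n : R := (k n)%:R / n%:R.
have xr : \forall n \near \oo, 0 < x n < alpha0 lambda.
  near=> n; apply/andP; split; last by near: n.
  near: n; move/cvgrPdist_lt : xa => /(_ _ a0); apply: filterS => n.
  by rewrite ltr_norml => /andP[]; rewrite -/(x n) ltrBlDr ltrDl.
pose u n := - zplus lambda (x n).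
have uc : u n @[n --> \oo] --> (1 : R).
  rewrite -(opprK 1); apply: cvgN; apply: (cvg_zplus _ _ _ xa); rewrite ?gt_eqF ?sqrrN ?expr1n//.
  rewrite /alpha0; field.
  by apply/and3P; split; apply/eqP; have := l0; have := l1; lra.
have mne : - lambda != 0 by rewrite oppr_eq0 gt_eqF.
have := @cvg_cubic_scale R (- lambda) left_m_bound mne u uc.
have dn : \forall n \near \oo, crit_dom (- lambda) (u n) /\ 0 < - lambda * (u n - 1).
  by apply: filterS xr => n xn; split; [exact: left_crit_dom|exact: left_side].
move=> /(_ dn) /(asymp_equiv_real (fun n => 3 / 2 * crit_value (- lambda) (u n))).
apply: asymp_equiv_near; first by apply: filterS xr => n xn; exact: left_gamma.
apply: filterS xr => n xn /=; congr (- ((_ `^ _ * _ `^ _) / _ `^ _))%:C.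
- have -> : (1 + - lambda) / (1 - - lambda) = alpha0 lambda by rewrite opprK.
  rewrite left_saddle_ratio// distrC ger0_norm// subr_ge0.
  by case/andP: xn => _ /ltW.
- by rewrite opprK.
- by rewrite normrN gtr0_norm.
Unshelve. all: by end_near. Qed.

Lemma gamma3_alpha0V_equiv (k : nat -> nat) :
  (k n)%:R / n%:R @[n --> \oo] --> (alpha0 lambda)^-1 ->
  (\forall n \near \oo, (alpha0 lambda)^-1 < (k n)%:R / n%:R) ->
  (fun n : nat => gamma3_alpha0V lambda ((k n)%:R / n%:R)) ~~[ \oo ]
  (fun n : nat =>
     let x : R := (k n)%:R / n%:R in
     (- (((x - (alpha0 lambda)^-1) `^ (3 / 2) * (1 - lambda) `^ (3 / 2))
           / (lambda * (1 + lambda)) `^ (1 / 2)))%:C).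
Proof.
move=> xa xr; have a0 := alpha0_gt0 _ lambda01.
pose x n : R := (k n)%:R / n%:R.
pose u n := zplus lambda (x n).
have uc : u n @[n --> \oo] --> (1 : R).
  apply: (cvg_zplus _ _ _ xa); rewrite ?invr_eq0 ?gt_eqF ?expr1n//.
  rewrite /alpha0 invf_div; field.
  by apply/and3P; split; apply/eqP; have := l0; have := l1; lra.
have mne : lambda != 0 by rewrite gt_eqF.
have := @cvg_cubic_scale R lambda right_m_bound mne u uc.
have dn : \forall n \near \oo, crit_dom lambda (u n) /\ 0 < lambda * (u n - 1).
  by apply: filterS xr => n xn; split; [exact: right_crit_dom|exact: right_side].
move=> /(_ dn) /(asymp_equiv_real (fun n => 3 / 2 * crit_value lambda (u n))).
apply: asymp_equiv_near; first by apply: filterS xr => n xn; exact: right_gamma.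
apply: filterS xr => n xn /=; congr (- ((_ `^ _ * _ `^ _) / _ `^ _))%:C.
- have -> : (1 + lambda) / (1 - lambda) = (alpha0 lambda)^-1 by rewrite /alpha0 invf_div.
  by rewrite right_saddle_ratio// ger0_norm// subr_ge0 ltW.
- by rewrite gtr0_norm.
Qed.

End GammaSaddle.

(** * Coefficients of fixed index *)

Section FixedIndex.
Context {R : realType}.

Lemma cvg_bin (j : nat) : 'C(n, j)%:R / n%:R ^+ j @[n --> \oo] --> (j`!%:R^-1 : R).
Proof.
elim: j => [|j ih].
  have -> : 0`!%:R^-1 = 1 :> R by rewrite fact0 invr1.
  rewrite (_ : (fun _ => _) = cst 1); first exact: cvg_cst.
  by apply/funext => n; rewrite bin0 mulr1.
have h : (j.+1%:R)^-1 * (1 - j%:R * n%:R^-1) * ('C(n, j)%:R / n%:R ^+ j)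
    @[n --> \oo] --> ((j.+1%:R)^-1 * (1 - j%:R * 0) * j`!%:R^-1 : R).
  apply: cvgM => //; apply: cvgM; first exact: cvg_cst.
  by apply: cvgB; [exact: cvg_cst|apply: cvgM; [exact: cvg_cst|exact: cvg_nV]].
rewrite mulr0 subr0 mulr1 -invfM -natrM -factS in h.
apply: cvg_trans h; apply: near_eq_cvg; near=> n.
have jn : (j < n)%N by near: n; exact: nbhs_infty_gt.
have n0 : n%:R != 0 :> R by rewrite pnatr_eq0 -lt0n (leq_trans _ jn).
have j0 : j.+1%:R != 0 :> R by rewrite pnatr_eq0.
have : (j.+1%:R * 'C(n, j.+1)%:R = (n%:R - j%:R) * 'C(n, j)%:R :> R).
  by rewrite -natrM mul_bin_left natrM natrB// ltnW.
move=> /(canRL (mulKf j0)) ->; rewrite exprS.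
have := expf_neq0 j n0; move: (n%:R ^+ j) (j.+1%:R^-1) => y v y0.
by field; rewrite n0 y0.
Unshelve. all: by end_near. Qed.

Lemma cvg_bin_rising (m : nat) : 'C((n + m).-1, m)%:R / n%:R ^+ m @[n --> \oo] --> (m`!%:R^-1 : R).
Proof.
elim: m => [|m ih].
  have -> : 0`!%:R^-1 = 1 :> R by rewrite fact0 invr1.
  rewrite (_ : (fun _ => _) = cst 1); first exact: cvg_cst.
  by apply/funext => n; rewrite bin0 mulr1.
have h : (m.+1%:R)^-1 * (1 + m%:R * n%:R^-1) * ('C((n + m).-1, m)%:R / n%:R ^+ m)
    @[n --> \oo] --> ((m.+1%:R)^-1 * (1 + m%:R * 0) * m`!%:R^-1 : R).
  apply: cvgM => //; apply: cvgM; first exact: cvg_cst.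
  by apply: cvgD; [exact: cvg_cst|apply: cvgM; [exact: cvg_cst|exact: cvg_nV]].
rewrite mulr0 addr0 mulr1 -invfM -natrM -factS in h.
apply: cvg_trans h; apply: near_eq_cvg; near=> n.
have n0' : (0 < n)%N by near: n; exact: nbhs_infty_gt.
have n0 : n%:R != 0 :> R by rewrite pnatr_eq0 -lt0n.
have m0 : m.+1%:R != 0 :> R by rewrite pnatr_eq0.
have : (m.+1%:R * 'C((n + m.+1).-1, m.+1)%:R = (n%:R + m%:R) * 'C((n + m).-1, m)%:R :> R).
  by rewrite addnS/= -natrM -mul_bin_diag natrM natrD.
move=> /(canRL (mulKf m0)) ->; rewrite exprS.
have := expf_neq0 m n0; move: (n%:R ^+ m) (m.+1%:R^-1) => y v y0.
by field; rewrite n0 y0.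
Unshelve. all: by end_near. Qed.

(** Every term of the Cauchy product has the same order [n ^ k]; the limits of the
    normalised terms add up to 1 by the binomial formula for
    [(1 - lambda ^ 2) ^ k]. *)
Lemma blaschke_coef_fixed (lambda : R) (k : nat) : 0 < lambda < 1 ->
  blaschke_coef lambda n k / ((- lambda) ^ (n%:Z - k%:Z) * (n%:R * (1 - lambda ^+ 2)) ^+ k / k`!%:R)
    @[n --> \oo] --> (1 : R).
Proof.
move=> /andP[l0 l1].
have l2 : 1 - lambda ^+ 2 != 0 by rewrite gt_eqF//; nra.
have ml : - lambda != 0 by rewrite oppr_eq0 gt_eqF.
have kf : k`!%:R != 0 :> R by rewrite pnatr_eq0 -lt0n fact_gt0.
pose T n (j : nat) : R := (- lambda ^+ 2) ^+ (k - j) * ('C(n, j)%:R / n%:R ^+ j)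
   * ('C((n + (k - j)).-1, k - j)%:R / n%:R ^+ (k - j)) * (k`!%:R / (1 - lambda ^+ 2) ^+ k).
have h : \sum_(j < k.+1) T n j @[n --> \oo] -->
    (\sum_(j < k.+1) (- lambda ^+ 2) ^+ (k - j) * j`!%:R^-1 * (k - j)`!%:R^-1
      * (k`!%:R / (1 - lambda ^+ 2) ^+ k) : R).
  apply: cvg_big; first exact: add_continuous.
  move=> j _; apply: cvgM; last exact: cvg_cst.
  apply: cvgM; last exact: cvg_bin_rising.
  by apply: cvgM; [exact: cvg_cst|exact: cvg_bin].
rewrite [X in _ --> X](_ : _ = 1) in h; last first.
  rewrite -mulr_suml mulrA.
  rewrite [X in X / _](_ : _ = (1 - lambda ^+ 2) ^+ k) ?divff ?expf_neq0//.
  rewrite addrC exprDn mulr_suml; apply: eq_bigr => j _.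
  rewrite expr1n mulr1 -[RHS]mulr_natr -!mulrA; congr (_ * _).
  rewrite -(bin_fact (ltn_ord j : (j <= k)%N)) !natrM.
  have a : j`!%:R != 0 :> R by rewrite pnatr_eq0 -lt0n fact_gt0.
  have b : (k - j)`!%:R != 0 :> R by rewrite pnatr_eq0 -lt0n fact_gt0.
  by field; rewrite a b.
apply: cvg_trans h; apply: near_eq_cvg; near=> n.
have kn : (k < n)%N by near: n; exact: nbhs_infty_gt.
have n0 : n%:R != 0 :> R by rewrite pnatr_eq0 -lt0n (leq_trans _ kn).
rewrite /blaschke_coef mulr_suml; apply: eq_bigr => j _.
have jk : (j <= k)%N by rewrite -ltnS.
rewrite subzn ?(ltnW kn)// -exprnP.
have -> : (n - j = (n - k) + (k - j))%N by lia.
rewrite exprD /T.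
have -> : (- lambda ^+ 2) ^+ (k - j) = (- lambda) ^+ (k - j) * lambda ^+ (k - j).
  by rewrite -exprMn; congr (_ ^+ _); ring.
rewrite [(n%:R * _) ^+ k]exprMn.
have -> : n%:R ^+ k = n%:R ^+ j * n%:R ^+ (k - j) :> R by rewrite -exprD subnKC.
rewrite -[_ ^+ (n - k) * _ *+ _]mulr_natr -[_ ^+ (k - j) *+ _]mulr_natr.
have := expf_neq0 (n - k) ml; have := expf_neq0 j n0; have := expf_neq0 (k - j) n0.
have := expf_neq0 k l2.
move: (n%:R ^+ j) (n%:R ^+ (k - j)) (_ ^+ k) ((- lambda) ^+ (n - k)) => a b c d c0 b0 a0 d0.
by field; rewrite kf c0 b0 a0 d0.
Unshelve. all: by end_near. Qed.

End FixedIndex.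

(** * The regimes of k / n *)

Section Regimes.
Context {R : realType} (lambda alpha : R).
Hypothesis lambda01 : 0 < lambda < 1.
Hypothesis alpha_range : 0 < alpha < alpha0 lambda.

Let a0 : 0 < alpha. Proof. by case/andP: alpha_range. Qed.
Let a1 : alpha < alpha0 lambda. Proof. by case/andP: alpha_range. Qed.
Let A0 : 0 < alpha0 lambda. Proof. exact: alpha0_gt0. Qed.
Let A1 : alpha0 lambda < 1. Proof. exact: alpha0_lt1. Qed.
Let AV : 1 < (alpha0 lambda)^-1. Proof. exact: alpha0V_gt1. Qed.
Let aV : (alpha0 lambda)^-1 < alpha^-1.
Proof. by rewrite ltf_pV2. Qed.

Variable k : nat -> nat.
Let x n : R := (k n)%:R / n%:R.
(* The quantity that has to vanish in [blaschke_coef_saddle]. *)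
Let err n := (n%:R * (x n + x n ^+ 3)) ^+ 4 / ((k n)%:R ^+ 2 * saddle_disc lambda (x n)) ^+ 3.

Lemma ler_expr4_div (a b A B : R) : 0 <= a -> a <= A -> 0 < B -> B <= b ->
  a ^+ 4 / b ^+ 3 <= A ^+ 4 / B ^+ 3.
Proof.
move=> h0 aA B0 Bb; have b0 := lt_le_trans B0 Bb; have hA := le_trans h0 aA.
apply: ler_pM.
- by rewrite exprn_ge0.
- by rewrite invr_ge0 exprn_ge0// ltW.
- by rewrite lerXn2r.
- by rewrite lef_pV2 ?posrE ?exprn_gt0// lerXn2r// nnegrE ltW.
Qed.

Lemma index_ratio n : (0 < n)%N -> n%:R * x n = (k n)%:R.
Proof. by move=> n0; rewrite /x mulrCA divff ?mulr1// pnatr_eq0 -lt0n. Qed.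

Lemma err_ge0 n : saddle_range lambda (x n) -> 0 <= err n.
Proof.
move=> xr; have D0 := saddle_disc_gt0 _ lambda01 _ xr.
have x0 := saddle_range_gt0 _ lambda01 _ xr.
apply: divr_ge0; apply: exprn_ge0; apply: mulr_ge0; rewrite ?sqr_ge0 ?(ltW D0)//.
by rewrite addr_ge0 ?exprn_ge0// ltW.
Qed.

Lemma away_range :
  k n @[n --> \oo] --> \oo ->
  (\forall n \near \oo, ((k n)%:R <= alpha * n%:R) \/ (alpha^-1 * n%:R <= (k n)%:R)) ->
  \forall n \near \oo, [/\ (0 < n)%N, (0 < k n)%N, saddle_range lambda (x n) &
     0 < x n <= alpha \/ alpha^-1 <= x n].
Proof.
move=> koo hk; near=> n.
have n0 : (0 < n)%N by near: n; exact: nbhs_infty_gt.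
have k0 : (0 < k n)%N.
  near: n; have /(_ [set m | (0 < m)%N]) := koo; apply; exact: nbhs_infty_gt.
have nR : 0 < n%:R :> R by rewrite ltr0n.
have x0 : 0 < x n by rewrite divr_gt0// ltr0n.
have hx : 0 < x n <= alpha \/ alpha^-1 <= x n.
  have [h|h] : ((k n)%:R <= alpha * n%:R) \/ (alpha^-1 * n%:R <= (k n)%:R) by near: n.
    by left; rewrite x0 ler_pdivrMr.
  by right; rewrite ler_pdivlMr.
split => //; case: hx => [/andP[_ h]|h]; [left|right].
  by rewrite x0 (le_lt_trans h).
exact: lt_le_trans aV h.
Unshelve. all: by end_near. Qed.

(** For [x <= alpha], [D] is bounded below and [err n = O (1 / k ^ 2)].  For
    [x >= 1 / alpha], [D >= d2 * x ^ 2] and [err n = O (1 / n ^ 2)], even if [x] is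
    unbounded. *)
Lemma away_err :
  k n @[n --> \oo] --> \oo ->
  (\forall n \near \oo, ((k n)%:R <= alpha * n%:R) \/ (alpha^-1 * n%:R <= (k n)%:R)) ->
  err n @[n --> \oo] --> (0 : R).
Proof.
move=> koo hk; have rg := away_range koo hk.
(* Lower bounds for [D] when [x <= alpha], for [D / x ^ 2] when [x >= 1 / alpha]. *)
pose d1 := (alpha0 lambda - alpha) * ((alpha0 lambda)^-1 - alpha).
pose d2 := (1 - alpha0 lambda * alpha) * (1 - alpha / alpha0 lambda).
have a_lt1 : alpha < 1 by exact: lt_trans a1 A1.
have d10 : 0 < d1 by rewrite mulr_gt0// subr_gt0// (lt_trans a_lt1).
have d20 : 0 < d2.
  rewrite mulr_gt0// subr_gt0; last by rewrite ltr_pdivrMr// mul1r.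
  by rewrite (lt_trans _ A1)// -[ltRHS]mulr1 ltr_pM2l.
have kV : ((k n)%:R)^-1 @[n --> \oo] --> (0 : R).
  apply/gtr0_cvgV0; last by apply/cvgrnyP.
  by apply: filterS rg => n [_ k0 _ _]; rewrite ltr0n.
have h : 16 / d1 ^+ 3 * ((k n)%:R)^-1 ^+ 2 + 16 / d2 ^+ 3 * (n%:R)^-1 ^+ 2
    @[n --> \oo] --> (16 / d1 ^+ 3 * 0 ^+ 2 + 16 / d2 ^+ 3 * 0 ^+ 2 : R).
  apply: cvgD; (apply: cvgM; first exact: cvg_cst); apply: cvg_expn => //.
  exact: cvg_nV.
rewrite expr0n/= !mulr0 addr0 in h.
apply: (squeeze_cvgr _ (cvg_cst 0) h); near=> n.
have [n0 k0 xr hx] : [/\ (0 < n)%N, (0 < k n)%N, saddle_range lambda (x n) &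
     0 < x n <= alpha \/ alpha^-1 <= x n] by near: n.
rewrite err_ge0//=.
have nR : 0 < n%:R :> R by rewrite ltr0n.
have kR : 0 < (k n)%:R :> R by rewrite ltr0n.
have nx := index_ratio _ n0.
have x0 := saddle_range_gt0 _ lambda01 _ xr.
have lhs0 : 0 <= n%:R * (x n + x n ^+ 3).
  by rewrite mulr_ge0 ?addr_ge0 ?exprn_ge0// ltW.
have x3 : 0 < x n ^+ 3 by rewrite exprn_gt0.
case: hx => [/andP[_ xa]|xa].
- apply: (@le_trans _ _ (16 / d1 ^+ 3 * ((k n)%:R)^-1 ^+ 2)); last first.
    by rewrite lerDl mulr_ge0 ?sqr_ge0// divr_ge0// exprn_ge0// ltW.
  have -> : 16 / d1 ^+ 3 * ((k n)%:R)^-1 ^+ 2 = (2 * (k n)%:R) ^+ 4 / ((k n)%:R ^+ 2 * d1) ^+ 3.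
    by field; rewrite !gt_eqF.
  apply: ler_expr4_div => //.
  + rewrite -nx mulrCA ler_pM2l//.
    have : x n ^+ 2 <= 1 by rewrite exprn_ile1 ?(ltW x0)// (le_trans xa)// ltW.
    by move=> h2; have : x n * x n ^+ 2 <= x n * 1 by [rewrite ler_pM2l]; rewrite -exprS; lra.
  + by rewrite mulr_gt0// exprn_gt0.
  + rewrite ler_pM2l ?exprn_gt0//; apply: ler_pM; rewrite ?subr_ge0 ?(ltW a1)//.
    * by rewrite ltW// (lt_trans a_lt1).
    * by rewrite lerD2l lerN2.
    * by rewrite lerD2l lerN2.
- apply: (@le_trans _ _ (16 / d2 ^+ 3 * (n%:R)^-1 ^+ 2)); last first.
    by rewrite lerDr mulr_ge0 ?sqr_ge0// divr_ge0// exprn_ge0// ltW.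
  have -> : 16 / d2 ^+ 3 * (n%:R)^-1 ^+ 2 = (n%:R * (2 * x n ^+ 3)) ^+ 4 /
      ((k n)%:R ^+ 2 * (x n ^+ 2 * d2)) ^+ 3.
    by rewrite -nx; field; rewrite !gt_eqF.
  have x1 : 1 < x n by rewrite (lt_le_trans AV)// (le_trans (ltW aV)).
  apply: ler_expr4_div => //.
  + rewrite ler_pM2l//.
    by have : x n <= x n ^+ 3 by [rewrite -{1}[x n]expr1 ler_weXn2l// ltW]; lra.
  + by rewrite mulr_gt0 ?exprn_gt0// mulr_gt0// exprn_gt0.
  + rewrite ler_pM2l ?exprn_gt0//.
    have xa' : 1 <= alpha * x n by rewrite -(mulfV (lt0r_neq0 a0)) ler_pM2l.
    have e1 : 0 <= 1 - alpha0 lambda * alpha.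
      by rewrite subr_ge0 (le_trans _ (ltW A1))// -[leRHS]mulr1 ler_pM2l// ltW.
    have e2 : 0 <= 1 - alpha / alpha0 lambda.
      by rewrite subr_ge0 ler_pdivrMr// mul1r ltW.
    have -> : x n ^+ 2 * d2 =
        (x n * (1 - alpha0 lambda * alpha)) * (x n * (1 - alpha / alpha0 lambda)).
      by rewrite /d2; ring.
    have -> : saddle_disc lambda (x n) = (x n - alpha0 lambda) * (x n - (alpha0 lambda)^-1).
      by rewrite /saddle_disc; ring.
    apply: ler_pM; rewrite ?mulr_ge0 ?(ltW x0)//.
    * have : alpha0 lambda * 1 <= alpha0 lambda * (alpha * x n) by rewrite ler_pM2l.
      by lra.
    * have : (alpha0 lambda)^-1 * 1 <= (alpha0 lambda)^-1 * (alpha * x n).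
        by rewrite ler_pM2l ?invr_gt0.
      by lra.
Unshelve. all: by end_near. Qed.

Variable omega : nat -> R.
Hypothesis omega_gt0 : forall n : nat, (0 < n)%N -> 0 < omega n.
Hypothesis omega_lower : (omega n / (n%:R : R) `^ (1 / 3)) @[n --> \oo] --> +oo.

(** With [x] bounded and [k ^ 2 D >= c * n * omega n], [err n] is at most a constant
    times [n / omega n ^ 3], the inverse of the cube of [omega n / n ^ (1 / 3)]. *)
Lemma transition_err (C c : R) : 0 < c ->
  (\forall n \near \oo, [/\ saddle_range lambda (x n), x n + x n ^+ 3 <= C
     & c * (n%:R * omega n) <= (k n)%:R ^+ 2 * saddle_disc lambda (x n)]) ->
  err n @[n --> \oo] --> (0 : R).
Proof.
move=> c0 hb.
have oV : (omega n / (n%:R : R) `^ (1 / 3))^-1 @[n --> \oo] --> (0 : R).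
  apply/gtr0_cvgV0 => //; near=> n.
  have n0 : (0 < n)%N by near: n; exact: nbhs_infty_gt.
  by rewrite divr_gt0 ?omega_gt0// powR_gt0// ltr0n.
have h : C ^+ 4 / c ^+ 3 * (omega n / (n%:R : R) `^ (1 / 3))^-1 ^+ 3
    @[n --> \oo] --> (C ^+ 4 / c ^+ 3 * 0 ^+ 3 : R).
  by apply: cvgM; [exact: cvg_cst|exact: cvg_expn].
rewrite expr0n/= mulr0 in h.
apply: (squeeze_cvgr _ (cvg_cst 0) h); near=> n.
have [xr xC kD] : [/\ saddle_range lambda (x n), x n + x n ^+ 3 <= C
     & c * (n%:R * omega n) <= (k n)%:R ^+ 2 * saddle_disc lambda (x n)] by near: n.
rewrite err_ge0//=.
have n0 : (0 < n)%N by near: n; exact: nbhs_infty_gt.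
have nR : 0 < n%:R :> R by rewrite ltr0n.
have x0 := saddle_range_gt0 _ lambda01 _ xr.
have o0 := omega_gt0 _ n0.
have -> : C ^+ 4 / c ^+ 3 * (omega n / n%:R `^ (1 / 3))^-1 ^+ 3 =
    (n%:R * C) ^+ 4 / (c * (n%:R * omega n)) ^+ 3.
  have : (n%:R `^ (1 / 3)) ^+ 3 = n%:R :> R.
    by rewrite -powR_mulrn ?powR_ge0// -powRrM div1r mulVf// powRr1// ltW.
  have := powR_gt0 (1 / 3) nR; move: (_ `^ _) => y y0 yn.
  rewrite -yn; field.
  by rewrite !gt_eqF.
apply: ler_expr4_div.
- by rewrite mulr_ge0 ?addr_ge0 ?exprn_ge0// ltW.
- by rewrite ler_pM2l.
- by rewrite !mulr_gt0.
- exact: kD.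
Unshelve. all: by end_near. Qed.

Let gap : 0 < (alpha0 lambda)^-1 - alpha0 lambda.
Proof. by rewrite subr_gt0 (lt_trans A1). Qed.

Lemma left_bounds :
  (\forall n \near \oo, alpha * n%:R <= (k n)%:R <= alpha0 lambda * n%:R - omega n) ->
  \forall n \near \oo, [/\ 0 < x n < alpha0 lambda, x n + x n ^+ 3 <= 2
     & alpha ^+ 2 * ((alpha0 lambda)^-1 - alpha0 lambda) * (n%:R * omega n)
       <= (k n)%:R ^+ 2 * saddle_disc lambda (x n)].
Proof.
move=> hk; near=> n.
have /andP[k1 k2] : alpha * n%:R <= (k n)%:R <= alpha0 lambda * n%:R - omega n by near: n.
have n0 : (0 < n)%N by near: n; exact: nbhs_infty_gt.
have nR : 0 < n%:R :> R by rewrite ltr0n.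
have o0 := omega_gt0 _ n0.
have nx := index_ratio _ n0.
have xa : alpha <= x n by rewrite ler_pdivlMr.
have xA : x n <= alpha0 lambda - omega n / n%:R.
  by rewrite ler_pdivrMr// mulrBl divfK ?gt_eqF.
have on0 : 0 < omega n / n%:R by rewrite divr_gt0.
have x0 : 0 < x n by exact: lt_le_trans xa.
have xA' : x n < alpha0 lambda by lra.
have x1 : x n <= 1 by rewrite ltW// (lt_trans xA').
split.
- by rewrite x0.
- have : x n ^+ 3 <= 1 by rewrite exprn_ile1 ?(ltW x0).
  lra.
- have -> : alpha ^+ 2 * ((alpha0 lambda)^-1 - alpha0 lambda) * (n%:R * omega n) =
      (n%:R * alpha) ^+ 2 * ((omega n / n%:R) * ((alpha0 lambda)^-1 - alpha0 lambda)).
    by field; rewrite !gt_eqF.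
  apply: ler_pM; rewrite ?sqr_ge0//.
  + by rewrite mulr_ge0// ltW.
  + by rewrite -nx lerXn2r ?nnegrE ?mulr_ge0 ?(ltW x0) ?(ltW a0)// ler_pM2l.
  + apply: ler_pM; rewrite ?(ltW on0) ?(ltW gap)//; first lra.
    by rewrite lerD2l lerN2 ltW.
Unshelve. all: by end_near. Qed.

Lemma right_bounds :
  (\forall n \near \oo, (alpha0 lambda)^-1 * n%:R + omega n <= (k n)%:R <= alpha^-1 * n%:R) ->
  \forall n \near \oo, [/\ (alpha0 lambda)^-1 < x n, x n + x n ^+ 3 <= alpha^-1 + alpha^-1 ^+ 3
     & ((alpha0 lambda)^-1 - alpha0 lambda) * (n%:R * omega n)
       <= (k n)%:R ^+ 2 * saddle_disc lambda (x n)].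
Proof.
move=> hk; near=> n.
have /andP[k1 k2] : (alpha0 lambda)^-1 * n%:R + omega n <= (k n)%:R <= alpha^-1 * n%:R by near: n.
have n0 : (0 < n)%N by near: n; exact: nbhs_infty_gt.
have nR : 0 < n%:R :> R by rewrite ltr0n.
have o0 := omega_gt0 _ n0.
have nx := index_ratio _ n0.
have xa : x n <= alpha^-1 by rewrite ler_pdivrMr.
have xA : (alpha0 lambda)^-1 + omega n / n%:R <= x n.
  by rewrite ler_pdivlMr// mulrDl divfK ?gt_eqF.
have on0 : 0 < omega n / n%:R by rewrite divr_gt0.
have xA' : (alpha0 lambda)^-1 < x n by lra.
have x1 : 1 < x n by rewrite (lt_trans AV).
have x0 : 0 < x n by lra.
split => //.
- have a0V : 0 <= alpha^-1 by rewrite invr_ge0 ltW.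
  by apply: lerD => //; rewrite lerXn2r ?nnegrE ?(ltW x0).
- have -> : ((alpha0 lambda)^-1 - alpha0 lambda) * (n%:R * omega n) =
      (n%:R * 1) ^+ 2 * (((alpha0 lambda)^-1 - alpha0 lambda) * (omega n / n%:R)).
    move: ((alpha0 lambda)^-1) => y; field; by rewrite !gt_eqF.
  have -> : saddle_disc lambda (x n) = (x n - alpha0 lambda) * (x n - (alpha0 lambda)^-1).
    by rewrite /saddle_disc; ring.
  apply: ler_pM; rewrite ?sqr_ge0//.
  + by rewrite mulr_ge0// ltW.
  + by rewrite -nx lerXn2r ?nnegrE ?mulr_ge0 ?(ltW x0)// ler_pM2l// ltW.
  + apply: ler_pM; rewrite ?(ltW on0) ?(ltW gap)//; last lra.
    by rewrite lerD2r ltW.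
Unshelve. all: by end_near. Qed.

Lemma left_err :
  (\forall n \near \oo, alpha * n%:R <= (k n)%:R <= alpha0 lambda * n%:R - omega n) ->
  err n @[n --> \oo] --> (0 : R).
Proof.
move=> /left_bounds hb; apply: transition_err; last first.
  by apply: filterS hb => n [xr xC kD]; split; [left| |exact: kD]; last exact: xC.
by rewrite mulr_gt0 ?exprn_gt0.
Qed.

Lemma right_err :
  (\forall n \near \oo, (alpha0 lambda)^-1 * n%:R + omega n <= (k n)%:R <= alpha^-1 * n%:R) ->
  err n @[n --> \oo] --> (0 : R).
Proof.
move=> /right_bounds hb; apply: transition_err; last first.
  by apply: filterS hb => n [xr xC kD]; split; [right| |exact: kD]; last exact: xC.
exact: gap.
Qed.

End Regimes.

Lemma prefactor_form {R : realType} (n k x D : R) : 0 < n -> 0 < x -> 0 < D -> n * x = k ->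
  1 / Num.sqrt (2 * k * pi) * (1 / D `^ (1 / 4)) =
  1 / Num.sqrt (2 * n * pi) * (1 / (Num.sqrt x * D `^ (1 / 4))).
Proof.
move=> n0 x0 D0 <-.
rewrite powR14 ?(ltW D0)//.
have -> : 2 * (n * x) * pi = 2 * n * pi * x by ring.
rewrite sqrtrM; last by rewrite !mulr_ge0 ?pi_ge0// ltW.
have sx : 0 < Num.sqrt x by rewrite sqrtr_gt0.
have sn : 0 < Num.sqrt (2 * n * pi) by rewrite sqrtr_gt0 !mulr_gt0// pi_gt0.
have sD : 0 < Num.sqrt (Num.sqrt D) by rewrite !sqrtr_gt0.
move: (Num.sqrt _) (Num.sqrt x) (Num.sqrt (Num.sqrt D)) sx sn sD => a b c b0 a0 c0.
by field; rewrite !gt_eqF.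
Qed.

Theorem theorem1 (R : realType) (lambda alpha : R) (omega : nat -> R)
    (lambda01 : 0 < lambda < 1)
    (alpha_range : 0 < alpha < alpha0 lambda)
    (omega_gt0 : forall n : nat, (0 < n)%N -> 0 < omega n)
    (omega_lower : (omega n / (n%:R : R) `^ (1 / 3)) @[n --> \oo] --> +oo)
    (omega_upper : (omega n / n%:R) @[n --> \oo] --> (0 : R)) :
  [/\ (* (1) *)
      forall k : nat,
        (fun n : nat => fourier_coef lambda n k) ~~[ \oo ]
        (fun n : nat =>
           ((- lambda) ^ (n%:Z - k%:Z)
              * (n%:R * (1 - lambda ^+ 2)) ^+ k / k`!%:R)%:C),
      (* (2) *)
      forall k : nat -> nat,
        k n @[n --> \oo] --> \oo ->
        (\forall n \near \oo,
           ((k n)%:R <= alpha * n%:R) \/ (alpha^-1 * n%:R <= (k n)%:R)) ->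
        (fun n : nat => fourier_coef lambda n (k n)) ~~[ \oo ]
        (fun n : nat =>
           let x : R := (k n)%:R / n%:R in
           let z : R[i] := (zplus lambda x)%:C in
           (1 / Num.sqrt (2 * (k n)%:R * pi)
              * (1 / ((alpha0 lambda - x) * ((alpha0 lambda)^-1 - x))
                       `^ (1 / 4)))%:C
           * (blaschke lambda z ^+ n * z ^- (k n))),
      (* (3) *)
      (forall k : nat -> nat,
        (\forall n \near \oo,
           alpha * n%:R <= (k n)%:R <= alpha0 lambda * n%:R - omega n) ->
        (fun n : nat => fourier_coef lambda n (k n)) ~~[ \oo ]
        (fun n : nat =>
           let x : R := (k n)%:R / n%:R in
           ((- 1) ^ (n%:Z - (k n)%:Z) / Num.sqrt (2 * n%:R * pi)
              * (1 / (Num.sqrt x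
                      * (((alpha0 lambda)^-1 - x) * (alpha0 lambda - x))
                          `^ (1 / 4)))
              * expR (- (2 / 3) * n%:R * modulus (gamma3_alpha0 lambda x)))%:C))
      /\
      (forall k : nat -> nat,
        (k n)%:R / n%:R @[n --> \oo] --> alpha0 lambda ->
        (\forall n \near \oo, (k n)%:R / n%:R < alpha0 lambda) ->
        (fun n : nat => gamma3_alpha0 lambda ((k n)%:R / n%:R)) ~~[ \oo ]
        (fun n : nat =>
           let x : R := (k n)%:R / n%:R in
           (- (((alpha0 lambda - x) `^ (3 / 2) * (1 + lambda) `^ (3 / 2))
                 / (lambda * (1 - lambda)) `^ (1 / 2)))%:C))
    & (* (4) *)
      (forall k : nat -> nat,
        (\forall n \near \oo,
           (alpha0 lambda)^-1 * n%:R + omega n <= (k n)%:R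
             <= alpha^-1 * n%:R) ->
        (fun n : nat => fourier_coef lambda n (k n)) ~~[ \oo ]
        (fun n : nat =>
           let x : R := (k n)%:R / n%:R in
           (1 / Num.sqrt (2 * n%:R * pi)
              * (1 / (Num.sqrt x
                      * ((x - (alpha0 lambda)^-1) * (x - alpha0 lambda))
                          `^ (1 / 4)))
              * expR (- (2 / 3) * n%:R * modulus (gamma3_alpha0V lambda x)))%:C))
      /\
      (forall k : nat -> nat,
        (k n)%:R / n%:R @[n --> \oo] --> (alpha0 lambda)^-1 ->
        (\forall n \near \oo, (alpha0 lambda)^-1 < (k n)%:R / n%:R) ->
        (fun n : nat => gamma3_alpha0V lambda ((k n)%:R / n%:R)) ~~[ \oo ]
        (fun n : nat =>
           let x : R := (k n)%:R / n%:R in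
           (- (((x - (alpha0 lambda)^-1) `^ (3 / 2) * (1 - lambda) `^ (3 / 2))
                 / (lambda * (1 + lambda)) `^ (1 / 2)))%:C)) ].
Proof.
split.
- move=> k; apply: (asymp_equiv_near _ (fun n => (blaschke_coef lambda n k)%:C) _ _ _ _
    (asymp_equiv_real _ _ (blaschke_coef_fixed lambda k lambda01))).
    by near=> n; rewrite fourier_coefE.
  by near=> n.
- move=> k koo hk.
  have rg := away_range lambda alpha lambda01 alpha_range k koo hk.
  have er := away_err lambda alpha lambda01 alpha_range k koo hk.
  have sr : \forall n \near \oo, saddle_range lambda ((k n)%:R / n%:R).
    by apply: filterS rg => n [].
  apply: (asymp_equiv_near _ _ _ _ _ _
    (asymp_equiv_real _ _ (blaschke_coef_saddle lambda lambda01 k sr er))).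
    by near=> n; rewrite fourier_coefE.
  by near=> n => /=; rewrite blaschke_real -!rmorphXn -fmorphV -!rmorphM.
- split; last by move=> k; exact: gamma3_alpha0_equiv.
  move=> k hk.
  have er := left_err lambda alpha lambda01 alpha_range k omega omega_gt0 omega_lower hk.
  have xr : \forall n \near \oo, (0 : R) < (k n)%:R / n%:R < alpha0 lambda.
    have bd := left_bounds lambda alpha lambda01 alpha_range k omega omega_gt0 hk.
    by apply: filterS bd => n [].
  have sr : \forall n \near \oo, saddle_range lambda ((k n)%:R / n%:R).
    by apply: filterS xr => n; left.
  apply: (asymp_equiv_near _ _ _ _ _ _
    (asymp_equiv_real _ _ (blaschke_coef_saddle lambda lambda01 k sr er))).
    by near=> n; rewrite fourier_coefE.
  near=> n => /=; congr (_%:C).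
  have xrn : (0 : R) < (k n)%:R / n%:R < alpha0 lambda by near: n.
  have n0 : (0 < n)%N by near: n; exact: nbhs_infty_gt.
  have nR : 0 < n%:R :> R by rewrite ltr0n.
  have nx : n%:R * ((k n)%:R / n%:R) = (k n)%:R :> R := index_ratio k n n0.
  have x0 : 0 < (k n)%:R / n%:R :> R by case/andP: xrn.
  rewrite (left_value lambda lambda01 _ xrn n (k n) nx).
  have D0 := saddle_disc_gt0 lambda lambda01 _ (or_introl xrn).
  rewrite (prefactor_form n%:R (k n)%:R _ _ nR x0 D0 nx).
  by rewrite /saddle_disc [(alpha0 lambda - _) * _]mulrC; ring.
- split; last by move=> k; exact: gamma3_alpha0V_equiv.
  move=> k hk.
  have er := right_err lambda alpha lambda01 alpha_range k omega omega_gt0 omega_lower hk.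
  have xr : \forall n \near \oo, (alpha0 lambda)^-1 < (k n)%:R / n%:R.
    have bd := right_bounds lambda alpha lambda01 alpha_range k omega omega_gt0 hk.
    by apply: filterS bd => n [].
  have sr : \forall n \near \oo, saddle_range lambda ((k n)%:R / n%:R).
    by apply: filterS xr => n; right.
  apply: (asymp_equiv_near _ _ _ _ _ _
    (asymp_equiv_real _ _ (blaschke_coef_saddle lambda lambda01 k sr er))).
    by near=> n; rewrite fourier_coefE.
  near=> n => /=; congr (_%:C).
  have xrn : (alpha0 lambda)^-1 < (k n)%:R / n%:R by near: n.
  have n0 : (0 < n)%N by near: n; exact: nbhs_infty_gt.
  have nR : 0 < n%:R :> R by rewrite ltr0n.
  have nx : n%:R * ((k n)%:R / n%:R) = (k n)%:R :> R := index_ratio k n n0.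
  have x0 := saddle_range_gt0 lambda lambda01 _ (or_intror xrn).
  rewrite (right_value lambda lambda01 _ xrn n (k n) nx).
  have D0 := saddle_disc_gt0 lambda lambda01 _ (or_intror xrn).
  rewrite (prefactor_form n%:R (k n)%:R _ _ nR x0 D0 nx).
  have -> // : saddle_disc lambda ((k n)%:R / n%:R) =
      ((k n)%:R / n%:R - (alpha0 lambda)^-1) * ((k n)%:R / n%:R - alpha0 lambda).
  by rewrite /saddle_disc; ring.
Unshelve. all: by end_near. Qed.
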